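(* There is a quasi-isometrically co-Hopfian visual roughly geodesic Gromov hyperbolic metric space $X$ whose boundary at infinity $\partial_\infty X$ is homeomorphic to the Menger curve.
   Context: A map $f:(X,d_X)\to(Y,d_Y)$ is a quasi-isometric embedding if there are $L\ge1$, $C>0$ with $L^{-1}d_X(x,y)-C\le d_Y(f(x),f(y))\le L\,d_X(x,y)+C$ for all $x,y\in X$; it is a quasi-isometry if in addition there is $C_1<\infty$ such that for every $z\in Y$ there is $x\in X$ with $d_Y(f(x),z)<C_1$. A metric space $X$ is quasi-isometrically co-Hopfian if every quasi-isometric embedding of $X$ into itself is a quasi-isometry. Gromov hyperbolicity and the boundary at infinity $\partial_\infty X$ (with the topology of visual metrics) are in the usual sense. ''Roughly geodesic'' and ''visual'' are in the sense of Bonk--Schramm: $X$ is roughly geodesic if there is $k\ge0$ such that any $x,y\in X$ are joined by a $k$-rough geodesic, i.e. a (not necessarily continuous) map $\gamma:[0,d(x,y)]\to X$ from $x$ to $y$ (up to error $k$) with $|s-t|-k\le d(\gamma(s),\gamma(t))\le|s-t|+k$; a Gromov hyperbolic space is visual if for some base point $o\in X$ there is $k\ge 0$ such that every point of $X$ lies on a $k$-rough geodesic ray starting at $o$. The (standard) Menger curve is $\mathscr{M}=\bigcap_{m\ge 0}E_m\subset\mathbb{R}^3$, where $E_0=[0,1]^3$, and $E_{m+1}$ is obtained from $E_m$ (a union of triadic cubes of side length $3^{-m}$) by dividing each of these cubes into $27$ congruent subcubes of side length $3^{-m-1}$ and removing the central subcube and the $6$ subcubes meeting the middle squares of its faces (so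 that the $20$ subcubes meeting the one-dimensional edges of the cube are kept, and each $E_m$ is closed). *)

(* Defs.v *)
From HB Require Import structures.
From mathcomp Require Import all_boot all_order all_algebra.
From mathcomp Require Import all_classical all_reals all_analysis.

Set Implicit Arguments.
Unset Strict Implicit.
Unset Printing Implicit Defensive.

Import Order.TTheory GRing.Theory Num.Theory.
Import numFieldTopology.Exports numFieldNormedType.Exports.

Local Open Scope classical_set_scope.
Local Open Scope ring_scope.

Section QuasiIsometry.
Context {R : realType}.

Definition quasi_isometric_embedding (X Y : metricType R) (f : X -> Y) : Prop :=
  exists L C : R, [/\ 1 <= L, 0 < C & forall x y : X,
    L^-1 * mdist x y - C <= mdist (f x) (f y) <= L * mdist x y + C].

Definition quasi_isometry (X Y : metricType R) (f : X -> Y) : Prop :=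
  quasi_isometric_embedding f /\
  exists C1 : R, forall z : Y, exists x : X, mdist (f x) z < C1.

Definition qi_coHopfian (X : metricType R) : Prop :=
  forall f : X -> X, quasi_isometric_embedding f -> quasi_isometry f.

End QuasiIsometry.

Section GromovHyperbolic.
Context {R : realType} (X : metricType R).

Definition gromov_product (o x y : X) : R :=
  (mdist o x + mdist o y - mdist x y) / 2.

Definition gromov_hyperbolic : Prop :=
  exists2 delta : R, 0 <= delta & forall o x y z : X,
    Num.min (gromov_product o x y) (gromov_product o y z) - delta
      <= gromov_product o x z.

(* The values of [g] outside of [I] are irrelevant. *)
Definition rough_isometric_on (k : R) (I : set R) (g : R -> X) : Prop :=
  forall s t : R, I s -> I t ->
    `|s - t| - k <= mdist (g s) (g t) <= `|s - t| + k.

Definition rough_geodesic (k : R) (x y : X) (g : R -> X) : Prop :=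
  [/\ rough_isometric_on k `[0, mdist x y] g,
      mdist (g 0) x <= k & mdist (g (mdist x y)) y <= k].

Definition roughly_geodesic : Prop :=
  exists2 k : R, 0 <= k &
    forall x y : X, exists g : R -> X, rough_geodesic k x y g.

Definition rough_ray (k : R) (o : X) (g : R -> X) : Prop :=
  rough_isometric_on k `[0, +oo[ g /\ g 0 = o.

Definition visual : Prop :=
  exists o : X, exists2 k : R, 0 <= k & forall x : X,
    exists2 g : R -> X, rough_ray k o g & exists2 t : R, 0 <= t & g t = x.

End GromovHyperbolic.

Section Boundary.
Context {R : realType} (X : metricType R).

Definition converges_at_infinity (o : X) (u : nat -> X) : Prop :=
  (fun p : nat * nat => gromov_product o (u p.1) (u p.2))
    @ filter_prod \oo \oo --> +oo.

Definition asymptotic (o : X) (u v : nat -> X) : Prop :=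
  (fun n => gromov_product o (u n) (v n)) @ \oo --> +oo.

Definition boundary_class (o : X) (u : nat -> X) : set (nat -> X) :=
  [set v | converges_at_infinity o v /\ asymptotic o u v].

(* In a Gromov hyperbolic space, [asymptotic o] is an equivalence relation on
   the sequences converging at infinity, and neither of the two notions depends
   on the base point [o].  The quotient is realized as the set of its classes. *)
Definition gromov_boundary (o : X) : Type :=
  set_type [set xi | exists2 u, converges_at_infinity o u
                              & xi = boundary_class o u].

HB.instance Definition _ (o : X) := gen_eqMixin (gromov_boundary o).
HB.instance Definition _ (o : X) := gen_choiceMixin (gromov_boundary o).

Definition boundary_gromov_product (o : X) (xi eta : gromov_boundary o)
    : \bar R :=
  ereal_sup [set limn_einf (fun n => (gromov_product o (u n) (v n))%:E)
            | u in set_val xi & v in set_val eta].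

(* Since [expeR -oo = 0], the visual inequalities also make sense when
   [boundary_gromov_product xi eta = +oo], that is, when [xi = eta]. *)
Record visual_metric (o : X) : Type := VisualMetric {
  vdist :> gromov_boundary o -> gromov_boundary o -> R ;
  vdistxx : forall xi, vdist xi xi = 0 ;
  vdist_positivity : forall xi eta, vdist xi eta = 0 -> xi = eta ;
  vdist_sym : forall xi eta, vdist xi eta = vdist eta xi ;
  vdist_triangle : forall zeta xi eta,
    vdist xi eta <= vdist xi zeta + vdist zeta eta ;
  vdist_visual : exists eps C : R, [/\ 0 < eps, 1 <= C & forall xi eta,
    ((C^-1)%:E * expeR (- (eps%:E * boundary_gromov_product xi eta))
        <= (vdist xi eta)%:E
        <= C%:E * expeR (- (eps%:E * boundary_gromov_product xi eta)))%E] }.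

Definition visual_boundary (o : X) (rho : visual_metric o) : Type :=
  gromov_boundary o.

HB.instance Definition _ (o : X) (rho : visual_metric o) :=
  Choice.on (visual_boundary rho).
HB.instance Definition _ (o : X) (rho : visual_metric o) :=
  isMetric.Build R (visual_boundary rho)
    (vdistxx rho) (@vdist_positivity _ rho) (vdist_sym rho) (vdist_triangle rho).

End Boundary.

Definition homeomorphic (S T : topologicalType) : Prop :=
  exists (f : S -> T) (g : T -> S),
    [/\ cancel f g, cancel g f, continuous f & continuous g].

(* All visual metrics of a Gromov hyperbolic space, for all base points, induce
   the same topology on the boundary. *)
Definition boundary_homeomorphic_to {R : realType} (X : metricType R)
    (T : topologicalType) : Prop :=
  exists (o : X) (rho : visual_metric o), homeomorphic (visual_boundary rho) T.

Section Menger.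
Context {R : realType}.

Definition triadic_cube (m : nat) (c : 'I_3 -> nat) : set 'rV[R]_3 :=
  [set x | forall i : 'I_3,
    (c i)%:R / 3%:R ^+ m <= x ord0 i <= (c i).+1%:R / 3%:R ^+ m].

(* [menger_cubes m c] holds when [triadic_cube m c] is one of the cubes of
   [menger_level m].  The position of this cube inside the cube of level
   [m.-1] containing it is given by the residues [c i %% 3]: the 7 removed
   positions are the ones where at least two of these residues are equal to 1. *)
Fixpoint menger_cubes (m : nat) : set ('I_3 -> nat) :=
  match m with
  | 0 => [set c | forall i, c i = 0%N]
  | m'.+1 => [set c | menger_cubes m' (fun i => c i %/ 3)%N /\
                      (#|[set i : 'I_3 | c i %% 3 == 1]%SET| <= 1)%N]
  end.

Definition menger_level (m : nat) : set 'rV[R]_3 :=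
  \bigcup_(c in menger_cubes m) triadic_cube m c.

Definition menger_curve : set 'rV[R]_3 := \bigcap_m menger_level m.

End Menger.
Arguments menger_curve R : clear implicits.

(* Main.v *)
Require Import Defs.
From HB Require Import structures.
From mathcomp Require Import all_boot all_order all_algebra.
From mathcomp Require Import all_classical all_reals all_analysis.
From mathcomp Require Import zify lra.
Import numFieldTopology.Exports numFieldNormedType.Exports.

(** The space is a hyperbolic cone over the Menger curve [Z], endowed with a
metric [d] adapted to the problem.  The points of the cone over a metric space of
diameter at most 1 are the pairs [(x, a)] of a point and a depth [a >= 0], with
the Bonk-Schramm distance
[2 ln (d x y + max (exp (- a)) (exp (- b))) + a + b].
Such a cone is Gromov hyperbolic, roughly geodesic and visual, whatever [d] is;
when [d] is complete its boundary at infinity is [Z], and [d] is a visual metric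
([boundary_cone]).  All the freedom left is thus in the choice of [d] among the
metrics of [Z] defining its topology.

The metric is chosen with spikes ([spiky]).  Fix points [p j] of [Z] visiting
every ball infinitely often, and depths [a j = epoch j] growing very fast.
Around [p j], at the scale [exp (- a j)], the metric separates more points than
there are cells, for the metric obtained before stage [j], in the cone up to a
depth about [j * a j].  This is possible since no point of [Z] is isolated and since the metric obtained
before stage [j] is totally bounded, the modifications of the later stages being
too small to be seen at that depth ([spiky_metric_exists]).

A quasi-isometric embedding [f] multiplies the depths by at most a constant, and
the images of points far from each other remain far from each other.  By the
pigeonhole principle, when [j] is large [f] must map the tip [(p j, a j)] of the
spike to a point lying below this tip, up to an error that does not depend on [j]
([spike_tip_image]).  Hence [f] maps the vertical segment above the tip to a
quasi-geodesic from the top of the cone to a point below the tip, and by stability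
of quasi-geodesics ([quasigeodesic_shadows_geodesic]) it passes at a bounded
distance from every point of the vertical segment that it shadows, hence from
every point of the cone close to the segment above the tip.  As the tips lie
below every point of the cone, [f] is coarsely onto ([spiky_cone_coHopfian]).

The argument applies to every nonempty compact metric space without isolated
points ([compact_perfect_coHopfian]), in particular to the Menger curve, where
each point is the limit of corners of triadic cubes. *)

Set Implicit Arguments.
Unset Strict Implicit.
Unset Printing Implicit Defensive.

Import Order.TTheory GRing.Theory Num.Theory.

Local Open Scope classical_set_scope.
Local Open Scope ring_scope.

(** * Stability of quasi-geodesics *)

Section Stability.
Context {R : realType} (X : metricType R).
Implicit Types (o x y z m : X) (h : nat -> X).

Lemma gromov_productC o x y : gromov_product o x y = gromov_product o y x.
Proof. by rewrite /gromov_product (metric_sym x y) (addrC (mdist o x)). Qed.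

Definition four_point (delta : R) := forall o x y z : X,
  Num.min (gromov_product o x y) (gromov_product o y z) - delta
    <= gromov_product o x z.

Lemma four_point_le delta o x y z b : four_point delta ->
  b <= gromov_product o x y -> b <= gromov_product o y z ->
  b - delta <= gromov_product o x z.
Proof.
move=> hyp bxy byz; apply: le_trans (hyp o x y z).
by rewrite lerB // le_min bxy.
Qed.

(** A path staying at distance [r] from [m] can turn around [m] only if it has
    exponentially many steps: bisecting a path of [2 ^ k] steps costs one
    [delta] at each of the [k] halvings. *)
Lemma gromov_product_chain delta h m n r c : four_point delta -> 0 <= c ->
  (forall i, (i <= n)%N -> r <= mdist m (h i)) ->
  (forall i, (i < n)%N -> mdist (h i) (h i.+1) <= c) ->
  forall k i j, (i <= j <= n)%N -> (j - i <= 2 ^ k)%N ->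
    r - c / 2 - k%:R * delta <= gromov_product m (h i) (h j).
Proof.
move=> hyp c0 far step; elim=> [|k IHk] i j /andP[ij jn] jik.
  have [eji|/eqP nji] := eqVneq i j.
    subst j; have := far i jn; rewrite /gromov_product mdistxx; lra.
  have eji : j = i.+1 by move: ij jik nji; rewrite expn0; lia.
  subst j; have := far i (ltnW jn); have := far i.+1 jn; have := step i jn.
  rewrite /gromov_product; lra.
pose l := (i + (j - i)./2)%N.
have e2 : (2 ^ k.+1 = 2 ^ k + 2 ^ k)%N by rewrite expnS; lia.
have il : (i <= l <= n)%N by rewrite /l; lia.
have lj : (l <= j <= n)%N by rewrite /l; lia.
have := @four_point_le delta m (h i) (h l) (h j) _ hyp
  (IHk i l il ltac:(rewrite /l; lia)) (IHk l j lj ltac:(rewrite /l; lia)).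
by rewrite -[k.+1]addn1 natrD; lra.
Qed.

Lemma gromov_product_chainC delta h m n r c : four_point delta -> 0 <= c ->
  (forall i, (i <= n)%N -> r <= mdist m (h i)) ->
  (forall i, (i < n)%N -> mdist (h i) (h i.+1) <= c) ->
  forall k i j, (i <= n)%N -> (j <= n)%N -> (`|i - j| <= 2 ^ k)%N ->
    r - c / 2 - k%:R * delta <= gromov_product m (h i) (h j).
Proof.
move=> hyp c0 far step k i j i_n jn ijk.
have [ij|ji] := leqP i j.
  by apply: (@gromov_product_chain _ _ _ n) => //; lia.
by rewrite gromov_productC; apply: (@gromov_product_chain _ _ _ n) => //; lia.
Qed.

End Stability.

Section LogBound.

Lemma exp2_up_log_le n : (2 ^ up_log 2 n <= 2 * n + 1)%N.
Proof.
have [n1|n1] := leqP n 1.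
  have -> : up_log 2 n = 0%N by apply/eqP; rewrite up_log_eq0 n1 orbT.
  by rewrite expn0 addn1.
have /andP[+ _] := up_log_bounds (isT : 1 < 2)%N n1.
have : (0 < up_log 2 n)%N by rewrite up_log_gt0 n1.
by case: (up_log _ _) => // k _ /=; rewrite expnS; lia.
Qed.

Context {R : realType}.

Lemma exp2_le_affine (P Q : R) (k : nat) : 0 <= P -> 0 <= Q ->
  2 ^+ k <= P + Q * k%:R -> k%:R <= 2 * (P + 2 * Q + 1).
Proof.
move=> P0 Q0 kPQ; pose H := (k./2).+1.
have kH : k%:R <= (2 * H)%:R - 1 :> R.
  rewrite lerBrDr natr1 ler_nat /H; lia.
have : (H * H)%:R <= 2 ^+ k :> R.
  rewrite -natrX ler_nat (@leq_trans (2 ^ k./2 * 2 ^ k./2)) //.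
    by rewrite leq_mul // ltn_expl.
  by rewrite -expnD leq_exp2l //; lia.
rewrite !natrM in kH *; have H1 : 1 <= H%:R :> R by rewrite ler1n.
move=> HH; suff : H%:R <= P + 2 * Q + 1 by lra.
rewrite leNgt; apply/negP => PH.
have QQ : Q * k%:R <= Q * (2%:R * H%:R - 1) by rewrite ler_wpM2l.
nra.
Qed.

(** Here [k] stands for the logarithm of a number of steps: a quantity that is
    at most the logarithm of an affine function of itself is bounded. *)
Lemma log_bootstrap (al be a b : R) : 0 <= al -> 0 <= be -> 0 <= a -> 0 <= b ->
  exists K, forall (k : nat) (r : R), r <= al + be * k%:R ->
    2 ^+ k <= a + b * r -> r <= K.
Proof.
move=> al0 be0 a0 b0.
pose P := a + b * al; pose Q := b * be.
exists (al + be * (2 * (P + 2 * Q + 1))) => k r rk kr.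
have P0 : 0 <= P by rewrite /P; nra.
have Q0 : 0 <= Q by rewrite /Q; nra.
have br : b * r <= b * (al + be * k%:R) by rewrite ler_wpM2l.
have /(exp2_le_affine P0 Q0) kb : 2 ^+ k <= P + Q * k%:R by rewrite /P /Q; lra.
by have := ler_wpM2l be0 kb; lra.
Qed.

End LogBound.

Section Morse.
Context {R : realType} (X : metricType R).

(** Let [v s] be a point of the geodesic whose distance [r] to the path is
    almost maximal.  The points of the geodesic at distance [2 r] on both sides
    of [v s] (or its ends) are at distance about [r] from the path, so that the
    part of the path between them has [O(r)] steps.  It avoids the ball of
    radius [r] around [v s], which forces [r = O(log r)]. *)
Lemma quasigeodesic_shadows_geodesic (delta c A K0 : R) :
  four_point X delta -> 0 <= delta -> 0 <= c -> 0 <= A -> 0 <= K0 ->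
  exists K, forall (n : nat) (h : nat -> X) (l : R) (v : R -> X),
    (forall s t, 0 <= s <= l -> 0 <= t <= l -> mdist (v s) (v t) = `|s - t|) ->
    (forall i, (i < n)%N -> mdist (h i) (h i.+1) <= c) ->
    (forall i j, (i <= n)%N -> (j <= n)%N ->
       `|i - j|%N%:R <= A * (mdist (h i) (h j) + 1)) ->
    mdist (h 0%N) (v 0) <= K0 -> mdist (h n) (v l) <= K0 ->
    forall s, 0 <= s <= l -> exists2 i, (i <= n)%N & mdist (h i) (v s) <= K.
Proof.
move=> hyp delta0 c0 A0 K00.
have [||||K1 K1P] := @log_bootstrap R (K0 + 1 + c / 2 + 2 * delta) delta
  (2 * A * (5 + 2 * K0) + 1) (12 * A); try nra.
exists (Num.max K1 0 + 2) => n h l v vgeo step qgeo h0 hn s sl.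
have l0 : 0 <= l by lra.
pose P := [set r | exists2 s, 0 <= s <= l &
  forall i, (i <= n)%N -> r <= mdist (h i) (v s)].
have hsP : has_sup P.
  split; first by exists 0, 0; rewrite ?lexx // => i _; exact: mdist_ge0.
  exists (l + K0) => x [t tl /(_ 0%N (leq0n _)) xh].
  apply: le_trans xh _; apply: le_trans (metric_triangle _ (v 0) _) _.
  rewrite vgeo //; last by rewrite lexx.
  by rewrite distrC subr0 ger0_norm; lra.
(* [m0] is the parameter of the point of the geodesic farthest from the path, up
   to the error 1 *)
have [r [m0 m0l far'] rS] := sup_adherent (ltr01) hsP.
have near t : 0 <= t <= l -> exists2 i, (i <= n)%N & mdist (h i) (v t) < r + 2.
  move=> tl; apply: contrapT => nex.
  suff : P (r + 2) by move/(ub_le_sup hsP.2); lra.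
  exists t => // i i_n; rewrite leNgt; apply/negP => hi.
  by apply: nex; exists i.
suff rK : r <= Num.max K1 0 by have [i i_n hi] := near s sl; exists i => //; lra.
rewrite le_max; have [//|r0] := leP r 0; rewrite ?orbT // orbF.
set m := v m0.
have far i : (i <= n)%N -> r <= mdist m (h i).
  by move=> i_n; rewrite metric_sym; exact: far'.
(* to the left of [m], either the point at distance [2 r], close to the path as
   [r] is almost maximal, or the origin of the geodesic *)
have [a [i [a0m ia hia mhi]]] : exists a i, [/\ 0 <= a <= m0 /\ m0 - a <= 2 * r,
    (i <= n)%N, mdist (h i) (v a) <= r + 2 + K0
    & r - K0 - 1 <= gromov_product m (v a) (h i)].
  have [m2r|m2r] := leP (2 * r) m0.
    have [|i i_n hi] := near (m0 - 2 * r); first by lra.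
    exists (m0 - 2 * r), i; split=> //; [lra|lra|].
    have := far i i_n; rewrite /gromov_product vgeo; [|lra|lra].
    rewrite ger0_norm; last lra.
    by rewrite (metric_sym (v (m0 - 2 * r)) (h i)); lra.
  exists 0, 0%N; split=> //; [lra|lra|].
  have f0 := far 0%N isT.
  have := metric_triangle m (v 0) (h 0%N).
  rewrite /gromov_product; rewrite !(metric_sym (v 0)) in h0 *; lra.
have [b [j [b0m jb hjb mhj]]] : exists b j, [/\ m0 <= b <= l /\ b - m0 <= 2 * r,
    (j <= n)%N, mdist (h j) (v b) <= r + 2 + K0
    & r - K0 - 1 <= gromov_product m (h j) (v b)].
  have [m2r|m2r] := leP (m0 + 2 * r) l.
    have [|j jn hj] := near (m0 + 2 * r); first by lra.
    exists (m0 + 2 * r), j; split=> //; [lra|lra|].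
    have := far j jn; rewrite /gromov_product vgeo; [|lra|lra].
    by rewrite ler0_norm; lra.
  exists l, n; split=> //; [lra|lra|].
  have fn := far n (leqnn _).
  by have := metric_triangle m (v l) (h n); rewrite /gromov_product;
    rewrite (metric_sym (v l)); lra.
have [[a0 bl] [am mb] abr] :
    [/\ 0 <= a /\ b <= l, a <= m0 /\ m0 <= b & b - a <= 4 * r].
  by clear -a0m b0m; do !split; lra.
clear a0m b0m.
pose k := up_log 2 `|i - j|.
have kP : (`|i - j| <= 2 ^ k)%N by exact: up_logP.
have chain := gromov_product_chainC hyp c0 far step ia jb kP.
have ab0 : gromov_product m (v a) (v b) = 0.
  rewrite /gromov_product /m !vgeo; clear -a0 bl am mb; try lra.
  by rewrite ger0_norm ?ler0_norm ?(distrC a) ?ger0_norm; lra.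
have bnd1 : r - K0 - 1 - c / 2 - k%:R * delta - delta - delta <= 0.
  have kd0 : 0 <= k%:R * delta by rewrite mulr_ge0.
  clear -ab0 mhi mhj chain hyp c0 delta0 kd0 K00.
  rewrite -ab0; apply: (@four_point_le _ _ _ _ _ (h j)) => //; last by lra.
  apply: (@four_point_le _ _ _ _ _ (h i)) => //; lra.
apply: (K1P k); first by clear -bnd1; lra.
have hij : mdist (h i) (h j) <= 6 * r + 4 + 2 * K0.
  have := metric_triangle (h i) (v a) (h j).
  have := metric_triangle (v a) (v b) (h j).
  rewrite vgeo; clear -hia hjb a0 bl am mb abr; try lra.
  by rewrite distrC ger0_norm ?(metric_sym (v b)); lra.
have qg := qgeo i j ia jb.
have qg' : A * (mdist (h i) (h j) + 1) <= A * (6 * r + 4 + 2 * K0 + 1).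
  by rewrite ler_wpM2l // lerD2r.
have := exp2_up_log_le `|i - j|; rewrite -/k -(ler_nat R) natrX natrD natrM.
by clear -qg qg'; lra.
Qed.

End Morse.

(** * The hyperbolic cone over a bounded metric space *)

Record bounded_metric (R : realType) (T : Type) : Type := BoundedMetric {
  bdist :> T -> T -> R ;
  bdistxx : forall x, bdist x x = 0 ;
  bdist_positivity : forall x y, bdist x y = 0 -> x = y ;
  bdistC : forall x y, bdist x y = bdist y x ;
  bdist_triangle : forall z x y, bdist x y <= bdist x z + bdist z y ;
  bdist_le1 : forall x y, bdist x y <= 1 }.

Section ConeDistance.
Context {R : realType} {T : Type} (d : bounded_metric R T).
Implicit Types (x y z : T) (p q r : T * R).

Lemma bdist_ge0 x y : 0 <= d x y.
Proof.
by have := bdist_triangle d y x x; rewrite bdistxx (bdistC d y x); lra.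
Qed.

(** This is [exp (- h)] for the depth [h] where the vertical lines through [p] and
    [q] separate, hence, up to a bounded factor, [exp (- (p|q))] for the Gromov
    product based at depth 0.  The geometry of the cone follows from the triangle
    inequality that it satisfies. *)
Definition merge_scale p q : R := d p.1 q.1 + Num.max (expR (- p.2)) (expR (- q.2)).

(** The distance of Bonk and Schramm, on all of [T * R]; only the points of
    nonnegative depth belong to the cone. *)
Definition cone_dist p q : R := 2 * ln (merge_scale p q) + p.2 + q.2.

Lemma expR_le_merge p q :
  (expR (- p.2) <= merge_scale p q) * (expR (- q.2) <= merge_scale p q).
Proof.
have := bdist_ge0 p.1 q.1; rewrite /merge_scale.
by split; rewrite -[leLHS]add0r lerD // le_max lexx ?orbT.
Qed.

Lemma merge_gt0 p q : 0 < merge_scale p q.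
Proof. exact: lt_le_trans (expR_gt0 _) (expR_le_merge p q).1. Qed.

Lemma mergeC p q : merge_scale p q = merge_scale q p.
Proof. by rewrite /merge_scale bdistC maxC. Qed.

Lemma merge_triangle r p q : merge_scale p q <= merge_scale p r + merge_scale r q.
Proof.
rewrite /merge_scale; have := bdist_triangle d r.1 p.1 q.1.
suff : Num.max (expR (- p.2)) (expR (- q.2)) <=
  Num.max (expR (- p.2)) (expR (- r.2)) + Num.max (expR (- r.2)) (expR (- q.2)).
  by lra.
rewrite ge_max; apply/andP; split.
  by rewrite -[leLHS]addr0 lerD // le_max ?lexx // expR_ge0.
by rewrite -[leLHS]add0r lerD // le_max ?lexx ?orbT // expR_ge0 orbT.
Qed.

Lemma cone_distC p q : cone_dist p q = cone_dist q p.
Proof. by rewrite /cone_dist mergeC addrAC. Qed.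

Lemma expR_ln_merge p q : expR (ln (merge_scale p q)) = merge_scale p q.
Proof. by apply: lnK; rewrite posrE merge_gt0. Qed.

Lemma cone_dist_le c s p q : 0 < c -> merge_scale p q <= c * expR (- s) ->
  cone_dist p q <= 2 * c - 2 * s + p.2 + q.2.
Proof.
move=> c0; rewrite -ler_ln ?posrE ?merge_gt0 ?mulr_gt0 ?expR_gt0 //.
rewrite lnM ?posrE ?expR_gt0 // expRK /cone_dist => ?.
by have := ln_sublinear c0; lra.
Qed.

Lemma cone_dist_ge s p q : expR (- s) <= merge_scale p q ->
  p.2 + q.2 - 2 * s <= cone_dist p q.
Proof.
rewrite -ler_ln ?posrE ?merge_gt0 ?mulr_gt0 ?expR_gt0 //.
by rewrite expRK /cone_dist; lra.
Qed.

Lemma merge_le (b : R) p q : cone_dist p q <= b ->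
  merge_scale p q <= expR ((b - p.2 - q.2) / 2).
Proof.
by rewrite /cone_dist => ?; rewrite -expR_ln_merge ler_expR; lra.
Qed.

Lemma base_le_expR (b : R) p q : cone_dist p q <= b ->
  d p.1 q.1 <= expR ((b - p.2 - q.2) / 2).
Proof.
move=> /merge_le; apply: le_trans.
by rewrite /merge_scale lerDl le_max expR_ge0.
Qed.

Lemma depth_lipschitz p q : `|p.2 - q.2| <= cone_dist p q.
Proof.
have [h1 h2] := expR_le_merge p q.
by rewrite ler_norml; have := cone_dist_ge h1; have := cone_dist_ge h2; lra.
Qed.

Lemma cone_dist_vertical x a b : cone_dist (x, a) (x, b) = `|a - b|.
Proof.
wlog ab : a b / a <= b => [wl|].
  by have [/wl//|/ltW/wl] := leP a b; rewrite cone_distC distrC.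
rewrite /cone_dist /merge_scale /= bdistxx add0r max_l ?ler_expR; last by lra.
by rewrite expRK ler0_norm; lra.
Qed.

Lemma cone_dist_horizontal x y a c : 0 <= c -> d x y <= c * expR (- a) ->
  cone_dist (x, a) (y, a) <= 2 * (c + 1).
Proof.
move=> c0 dxy; have -> : 2 * (c + 1) = 2 * (c + 1) - 2 * a + a + a by lra.
by apply: cone_dist_le; rewrite ?ltr_wpDl // mulrDl mul1r /merge_scale /= maxxx lerD2r.
Qed.

Lemma cone_dist_eq0 p q : cone_dist p q = 0 -> p = q.
Proof.
move=> pq0; have := depth_lipschitz p q; rewrite pq0 normr_le0 subr_eq0 => /eqP.
case: p q pq0 => x a [y b] /= + ab; rewrite -{b}ab => xy0.
have : merge_scale (x, a) (y, a) = expR (- a).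
  by rewrite -expR_ln_merge; congr expR; move: xy0; rewrite /cone_dist /=; lra.
rewrite /merge_scale /= maxxx => xya; have dxy : d x y = 0 by lra.
by rewrite (bdist_positivity dxy).
Qed.

(** After exponentiation, the triangle inequality of [cone_dist] is a
    submultiplicativity of [merge_scale], the depth of the middle point entering as
    a factor. *)
Lemma cone_dist_triangle r p q : cone_dist p q <= cone_dist p r + cone_dist r q.
Proof.
suff : merge_scale p q * expR (- r.2) <= merge_scale p r * merge_scale r q.
  rewrite -ler_ln ?posrE ?mulr_gt0 ?expR_gt0 ?merge_gt0 //.
  by rewrite !lnM ?posrE ?expR_gt0 ?merge_gt0 // expRK /cone_dist; lra.
rewrite /merge_scale; have := bdist_triangle d r.1 p.1 q.1.
have := bdist_ge0 p.1 r.1; have := bdist_ge0 r.1 q.1.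
have := expR_gt0 (- r.2); have := expR_gt0 (- p.2); have := expR_gt0 (- q.2).
move: (expR (- q.2)) (expR (- p.2)) (expR (- r.2)) => B A t.
move: (d p.1 q.1) (d p.1 r.1) (d r.1 q.1) => dpq dpr drq.
move=> B0 A0 t0 drq0 dpr0 tri.
set M := Num.max A B; set M1 := Num.max A t; set M2 := Num.max t B.
have [AM1 tM1] : A <= M1 /\ t <= M1 by rewrite /M1 !le_max !lexx orbT.
have [tM2 BM2] : t <= M2 /\ B <= M2 by rewrite /M2 !le_max !lexx orbT.
have : M * t <= M1 * M2.
  by rewrite /M /Num.max; case: ifP => _; [rewrite mulrC|]; apply: ler_pM;
    rewrite // ltW.
have := ler_wpM2l dpr0 tM2; have := ler_wpM2r drq0 tM1.
have := mulr_ge0 dpr0 drq0; have := ler_wpM2r (ltW t0) tri.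
by lra.
Qed.

(** The multiplicative form of the four-point condition.  When the smallest of
    the four factors on the right appears in one of the two products, the other
    product is the good one: each factor on the left is at most the sum of the
    smallest factor and of a factor of that other product. *)
Lemma merge_ptolemy (o x y z : T * R) :
  merge_scale x z * merge_scale o y <= 4 * (merge_scale x y * merge_scale o z) \/
  merge_scale x z * merge_scale o y <= 4 * (merge_scale y z * merge_scale o x).
Proof.
have xz1 := merge_triangle y x z; have xz2 := merge_triangle o x z.
have oy1 := merge_triangle x o y; have oy2 := merge_triangle z o y.
rewrite !(mergeC z y) !(mergeC x o) in xz1 xz2 oy1 oy2 *.
have := merge_gt0 x y; have := merge_gt0 o z.
have := merge_gt0 y z; have := merge_gt0 o x.
have := merge_gt0 x z; have := merge_gt0 o y.
move: (merge_scale x z) (merge_scale o y) (merge_scale x y) (merge_scale o z) (merge_scale y z) (merge_scale o x)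
  xz1 xz2 oy1 oy2 => xz oy xy oz yz ox xz1 xz2 oy1 oy2
  /ltW oy0 /ltW xz0 ox0 yz0 oz0 xy0.
have prod (a b a' b' : R) : 0 <= a -> 0 <= b -> a <= 2 * a' -> b <= 2 * b' ->
    a * b <= 4 * (a' * b').
  move=> a0 b0 aa bb; have := ler_pM a0 b0 aa bb; lra.
have swap (a b a' b' : R) : 0 <= a -> 0 <= b -> a <= 2 * b' -> b <= 2 * a' ->
    a * b <= 4 * (a' * b').
  by move=> a0 b0 aa bb; rewrite (mulrC a'); exact: prod.
have [h1|h1] := leP xy yz; have [h2|h2] := leP xy ox.
- by right; apply: prod => //; lra.
- have [h3|h3] := leP ox oz; first by left; apply: swap => //; lra.
  by right; apply: swap => //; lra.
- have [h3|h3] := leP yz oz; first by left; apply: prod => //; lra.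
  by right; apply: swap => //; lra.
- have [h3|h3] := leP yz ox; have [h4|h4] := leP oz (Num.min yz ox).
  + by right; move: h4; rewrite le_min => /andP[? ?]; apply: swap => //; lra.
  + by left; move: h4; rewrite min_l // => ?; apply: prod => //; lra.
  + by right; move: h4; rewrite le_min => /andP[? ?]; apply: swap => //; lra.
  + by left; move: h4; rewrite min_r ?(ltW h3) // => ?; apply: swap => //; lra.
Qed.

End ConeDistance.

Section ConeSpace.
Context {R : realType} {T : choiceType}.
Implicit Type d : bounded_metric R T.

Definition cone d : Type := (T * {a : R | 0 <= a})%type.

Definition cone_coord d (p : cone d) : T * R := (p.1, val p.2).

HB.instance Definition _ d := Choice.on (cone d).

Fact cone_coord_inj d : injective (@cone_coord d).
Proof. by move=> [x a] [y b] [-> /val_inj ->]. Qed.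

HB.instance Definition _ d := isMetric.Build R (cone d)
  (fun p => etrans (cone_dist_vertical d p.1 (val p.2) (val p.2))
              (etrans (congr1 Num.norm (subrr _)) (normr0 _)))
  (fun p q pq0 => cone_coord_inj (@cone_dist_eq0 _ _ d _ _ pq0))
  (fun p q => cone_distC d (cone_coord p) (cone_coord q))
  (fun r p q => cone_dist_triangle d (cone_coord r) (cone_coord p) (cone_coord q)).

Definition depth d (p : cone d) : R := val p.2.

Fact max0_ge0 (a : R) : 0 <= Num.max 0 a. Proof. by rewrite le_max lexx. Qed.

(** Negative depths are clamped to 0, so that paths may be defined by arbitrary
    real parameters. *)
Definition cone_point d (x : T) (a : R) : cone d :=
  (x, exist _ (Num.max 0 a) (max0_ge0 a)).

End ConeSpace.

Section ConeGeometry.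
Context {R : realType} {T : choiceType} (d : bounded_metric R T).
Implicit Types (p q : cone d) (x y : T).

Lemma mdist_coneE p q :
  mdist p q = cone_dist d (cone_coord p) (cone_coord q).
Proof. by []. Qed.

Lemma depth_ge0 p : 0 <= depth p. Proof. exact: valP p.2. Qed.

Lemma cone_coordE p : cone_coord p = (p.1, depth p). Proof. by []. Qed.

Lemma depth_cone_point x a : 0 <= a -> depth (cone_point d x a) = a.
Proof. by move=> a0; rewrite /depth /= max_r. Qed.

Lemma coord_cone_point x a : 0 <= a -> cone_coord (cone_point d x a) = (x, a).
Proof. by move=> a0; rewrite cone_coordE depth_cone_point. Qed.

Lemma cone_pointE p : cone_point d p.1 (depth p) = p.
Proof.
apply: cone_coord_inj; rewrite coord_cone_point //; exact: depth_ge0.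
Qed.

Lemma mdist_cone_point x y a b : 0 <= a -> 0 <= b ->
  mdist (cone_point d x a) (cone_point d y b) = cone_dist d (x, a) (y, b).
Proof. by move=> a0 b0; rewrite mdist_coneE !coord_cone_point. Qed.

Lemma mdist_vertical x a b : 0 <= a -> 0 <= b ->
  mdist (cone_point d x a) (cone_point d x b) = `|a - b|.
Proof. by move=> a0 b0; rewrite mdist_cone_point // cone_dist_vertical. Qed.

Lemma mdist_cone_depth p q : `|depth p - depth q| <= mdist p q.
Proof. exact: (depth_lipschitz d (cone_coord p) (cone_coord q)). Qed.

Lemma gromov_product_cone (o p q : cone d) :
  gromov_product o p q = depth o + ln (merge_scale d (cone_coord o) (cone_coord p))
    + ln (merge_scale d (cone_coord o) (cone_coord q))
    - ln (merge_scale d (cone_coord p) (cone_coord q)).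
Proof.
rewrite /gromov_product !mdist_coneE /cone_dist -[depth o]/(cone_coord o).2.
move: (ln _) (ln _) (ln _) (cone_coord o).2 (cone_coord p).2 (cone_coord q).2.
by move=> *; lra.
Qed.

Lemma cone_four_point : four_point (cone d) (ln 4).
Proof.
move=> o x y z; rewrite !gromov_product_cone.
rewrite lerBlDr ge_min; apply/orP.
have := merge_ptolemy d (cone_coord o) (cone_coord x) (cone_coord y) (cone_coord z).
have c0 := @merge_gt0 R T d.
by case=> [H|H]; [left|right]; move: H;
  rewrite -ler_ln ?posrE ?mulr_gt0 ?c0 // !lnM ?posrE ?mulr_gt0 ?c0 //; lra.
Qed.

Lemma gromov_hyperbolic_cone : gromov_hyperbolic (cone d).
Proof. by exists (ln 4); [rewrite ln_ge0 ?ler1n | exact: cone_four_point]. Qed.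

(** Clamping moves a point of depth at least -1 by at most 1. *)
Lemma mdist_cone_point_clamp x y a b : -1 <= a -> -1 <= b ->
  `|mdist (cone_point d x a) (cone_point d y b) - cone_dist d (x, a) (y, b)| <= 2.
Proof.
move=> a1 b1.
have clamp z (c : R) : -1 <= c -> cone_dist d (z, Num.max 0 c) (z, c) <= 1.
  by move=> c1; rewrite cone_dist_vertical ler_norml; case: (leP 0 c) => ?; lra.
rewrite ler_norml mdist_coneE !cone_coordE /depth /=.
have := clamp x a a1; have := clamp y b b1.
set x0 := (x, Num.max 0 a); set y0 := (y, Num.max 0 b).
have := cone_dist_triangle d (x, a) x0 y0.
have := cone_dist_triangle d (y, b) (x, a) y0.
have := cone_dist_triangle d x0 (x, a) (y, b).
have := cone_dist_triangle d y0 x0 (y, b).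
by rewrite (cone_distC d (y, b) y0) (cone_distC d (x, a) x0); lra.
Qed.

(** Along a vertical segment down to [p] and another one down to [q], both starting
    at the depth [h] where the lines separate, the cone distance is the length of
    the path going through depth [h], up to the cost 4 of the horizontal jump. *)
Lemma cone_dist_merging x y (h a b u v : R) : merge_scale d (x, a) (y, b) = expR (- h) ->
  h <= u <= a -> h <= v <= b ->
  u + v - 2 * h <= cone_dist d (x, u) (y, v) <= u + v - 2 * h + 4.
Proof.
move=> eh /andP[hu ua] /andP[hv vb]; apply/andP; split.
  apply: (@cone_dist_ge _ _ d h (x, u) (y, v)); rewrite -eh /merge_scale /= lerD2l ge_max !le_max !ler_expR.
  by rewrite !lerN2 ua vb orbT.
have -> : u + v - 2 * h + 4 = 2 * 2 - 2 * h + u + v by lra.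
apply: (@cone_dist_le _ _ d 2 h (x, u) (y, v)) => //.
rewrite mulr2n mulrDl !mul1r /merge_scale /=.
apply: lerD; last by rewrite ge_max !ler_expR !lerN2 hu hv.
by rewrite -eh /merge_scale /= lerDl le_max expR_ge0.
Qed.

(** The rough geodesic climbs from [p] to the depth [h] where the vertical lines
    separate, jumps to the line of [q] and goes down to [q].  As [h] may be slightly
    negative, the constant is 4 for the jump plus 2 for the clamping. *)
Lemma roughly_geodesic_cone : roughly_geodesic (cone d).
Proof.
exists 6 => // p q; set a := depth p; set b := depth q.
pose h := - ln (merge_scale d (cone_coord p) (cone_coord q)).
have eh : merge_scale d (p.1, a) (q.1, b) = expR (- h).
  by rewrite /h opprK expR_ln_merge.
have [ha hb] : h <= a /\ h <= b.
  have [] := expR_le_merge d (p.1, a) (q.1, b).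
  by rewrite /= eh !ler_expR !lerN2.
have h1 : -1 <= h.
  rewrite -lerN2 -ler_expR -eh.
  have := @expR_ge1Dx R (- -1); have := bdist_le1 d p.1 q.1.
  have : Num.max (expR (- a)) (expR (- b)) <= 1.
    by rewrite ge_max !expR_le1 !oppr_le0 !depth_ge0.
  by rewrite /merge_scale /=; lra.
have Dpq : mdist p q = a + b - 2 * h.
  rewrite mdist_coneE /cone_dist -[(cone_coord p).2]/a -[(cone_coord q).2]/b.
  by rewrite /h; lra.
pose g s := if s < a - h then cone_point d p.1 (a - s)
            else cone_point d q.1 (h + (s - (a - h))).
exists g; split.
- suff W s t : 0 <= s -> t <= mdist p q -> s <= t ->
      t - s - 6 <= mdist (g s) (g t) <= t - s + 6.
    move=> s t; rewrite /= !in_itv /= => /andP[s0 sD] /andP[t0 tD].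
    have [st|/ltW ts] := leP s t.
      by rewrite distrC [`|t - s|]ger0_norm ?subr_ge0 // W.
    by rewrite [`|s - t|]ger0_norm ?subr_ge0 // metric_sym W.
  rewrite Dpq => s0 tD st; rewrite /g.
  case: ltP => sh; case: ltP => th; last first.
  + have := @mdist_cone_point_clamp q.1 q.1 (h + (s - (a - h)))
      (h + (t - (a - h))) ltac:(lra) ltac:(lra).
    rewrite cone_dist_vertical ler_norml => H.
    have e : `|h + (s - (a - h)) - (h + (t - (a - h)))| = t - s.
      by rewrite ler0_norm; lra.
    by rewrite e in H; lra.
  + by lra.
  + have := @mdist_cone_point_clamp p.1 q.1 (a - s)
      (h + (t - (a - h))) ltac:(lra) ltac:(lra).
    have := @cone_dist_merging p.1 q.1 h a b (a - s) (h + (t - (a - h))) eh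
      ltac:(lra) ltac:(lra).
    by rewrite ler_norml; lra.
  + have := @mdist_cone_point_clamp p.1 p.1 (a - s)
      (a - t) ltac:(lra) ltac:(lra).
    rewrite cone_dist_vertical ler_norml => H.
    have e : `|a - s - (a - t)| = t - s.
      by rewrite ger0_norm; lra.
    by rewrite e in H; lra.
- rewrite /g; case: ltP => h0.
    by rewrite subr0 cone_pointE mdistxx.
  have := @mdist_cone_point_clamp q.1 p.1 (h + (0 - (a - h))) a ltac:(lra) ltac:(lra).
  have := @cone_dist_merging p.1 q.1 h a b a (h + (0 - (a - h))) eh
    ltac:(lra) ltac:(lra).
  by rewrite cone_pointE cone_distC ler_norml; lra.
- have notlt : (a + b - 2 * h < a - h) = false by apply/negbTE; rewrite -leNgt; lra.
  rewrite /g Dpq notlt.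
  have -> : h + (a + b - 2 * h - (a - h)) = b by lra.
  by rewrite cone_pointE mdistxx.
Qed.

(** A vertical ray preceded by a jump from the base point.  The shift by 1 leaves
    the parameter 0 to the base point, while all the points of the line of [p],
    also at depth 0, are reached later. *)
Lemma visual_cone : T -> visual (cone d).
Proof.
move=> x0; exists (cone_point d x0 0); exists 7 => // p.
pose g t := if t == 0 then cone_point d x0 0 else cone_point d p.1 (t - 1).
exists g; last first.
  exists (depth p + 1); first by rewrite addr_ge0 ?depth_ge0.
  by rewrite /g gt_eqF ?ltr_wpDl ?depth_ge0 // addrK cone_pointE.
split; last by rewrite /g eqxx.
suff W s t : 0 <= s -> s <= t -> t - s - 7 <= mdist (g s) (g t) <= t - s + 7.
  move=> s t; rewrite /= !in_itv /= !andbT => s0 t0.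
  have [st|/ltW ts] := leP s t.
    by rewrite distrC [`|t - s|]ger0_norm ?subr_ge0 // W.
  by rewrite [`|s - t|]ger0_norm ?subr_ge0 // metric_sym W.
move=> s0 st; rewrite /g; have [sz|snz] := eqVneq s 0.
  have [tz|tnz] := eqVneq t 0; first by rewrite sz tz subrr mdistxx; lra.
  have t0 : 0 < t by rewrite lt_neqAle eq_sym tnz; lra.
  have := @mdist_cone_point_clamp x0 p.1 0 (t - 1) ltac:(lra) ltac:(lra).
  have := depth_lipschitz d (x0, 0) (p.1, t - 1).
  have := cone_dist_triangle d (p.1, 0) (x0, 0) (p.1, t - 1).
  have := @cone_dist_horizontal _ _ d x0 p.1 0 1 ler01.
  rewrite oppr0 expR0 mulr1 bdist_le1 => /(_ isT).
  rewrite cone_dist_vertical !ler_norml /= sz.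
  have : `|0 - (t - 1)| <= t + 1 by rewrite ler_norml; lra.
  by lra.
have := @mdist_cone_point_clamp p.1 p.1 (s - 1) (t - 1) ltac:(lra) ltac:(lra).
have sp : 0 < s by rewrite lt_neqAle eq_sym snz.
rewrite (gt_eqF (lt_le_trans sp st)) cone_dist_vertical ler_norml => H.
have e : `|s - 1 - (t - 1)| = t - s by rewrite ler0_norm; lra.
by rewrite e in H; lra.
Qed.

End ConeGeometry.

(** * The boundary of the cone *)

Definition bdist_complete (R : realType) (T : Type) (d : bounded_metric R T) :=
  forall s : nat -> T,
  (forall e, 0 < e -> exists N, forall i j, (N <= i)%N -> (N <= j)%N ->
     d (s i) (s j) < e) ->
  exists x, forall e, 0 < e -> exists N, forall i, (N <= i)%N -> d (s i) x < e.

Section ConeBoundary.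
Context {R : realType} {T : choiceType} (d : bounded_metric R T) (x0 : T).
Implicit Types (p q : cone d) (x y : T) (u v : nat -> cone d).

Let o : cone d := cone_point d x0 0.

Definition cone_merge p q : R := merge_scale d (cone_coord p) (cone_coord q).

Lemma base_le_merge p q : d p.1 q.1 <= cone_merge p q.
Proof. by rewrite lerDl le_max expR_ge0. Qed.

Lemma expR_depth_le1 p : expR (- depth p) <= 1.
Proof. by rewrite expR_le1 oppr_le0 depth_ge0. Qed.

Lemma merge_apex p : merge_scale d (cone_coord o) (cone_coord p) = 1 + d x0 p.1.
Proof.
rewrite coord_cone_point // /merge_scale /= oppr0 expR0 max_l 1?addrC //.
exact: expR_depth_le1.
Qed.

Lemma bdist_gt0 x y : x != y -> 0 < d x y.
Proof.
move=> xy; rewrite lt_neqAle bdist_ge0 andbT eq_sym.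
by apply: contraNneq xy => e; rewrite (bdist_positivity e).
Qed.

Lemma ln_base_itv x y : 0 <= ln (1 + d x y) <= 1.
Proof.
have d0 := bdist_ge0 d x y; apply/andP; split; first by rewrite ln_ge0 // lerDl.
apply: le_trans (bdist_le1 d x y); apply: le_ln1Dx; lra.
Qed.

Lemma gromov_product_apex p q : gromov_product o p q =
  ln (1 + d x0 p.1) + ln (1 + d x0 q.1) - ln (cone_merge p q).
Proof.
by rewrite gromov_product_cone !merge_apex depth_cone_point // add0r.
Qed.

(** As the Gromov product at the base point is [- ln (cone_merge p q)] up to 2, the
    two notions of convergence to infinity, for sequences and for double sequences,
    are instances of the same statement about an arbitrary filter. *)
Lemma gromov_product_cvgy (I : Type) (F : set_system I) (p q : I -> cone d) :
  Filter F ->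
  (fun i => gromov_product o (p i) (q i)) @ F --> +oo <->
  forall e, 0 < e -> \forall i \near F, cone_merge (p i) (q i) < e.
Proof.
move=> FF; split=> [/cvgryPgt pq e e0|pq].
  apply: filterS (pq (2 - ln e)) => i.
  rewrite gromov_product_apex => lt.
  rewrite -ltr_ln ?posrE ?merge_gt0 //.
  by have := ln_base_itv x0 (p i).1; have := ln_base_itv x0 (q i).1; lra.
apply/cvgryPgt => A; apply: filterS (pq _ (expR_gt0 (- A))) => i.
rewrite -ltr_ln ?posrE ?merge_gt0 ?expR_gt0 // expRK gromov_product_apex => lt.
by have := ln_base_itv x0 (p i).1; have := ln_base_itv x0 (q i).1; lra.
Qed.

(** The sequence [u] of points of the cone tends to the ideal point [x]: its
    projection tends to [x] and its depth to infinity. *)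
Definition cone_cvg u x := forall e : R, 0 < e ->
  \forall n \near \oo, d (u n).1 x + expR (- depth (u n)) < e.

Lemma merge_le_sum p q x :
  cone_merge p q <= (d p.1 x + expR (- depth p)) + (d q.1 x + expR (- depth q)).
Proof.
have := bdist_triangle d x p.1 q.1; rewrite (bdistC d x q.1) => tri.
have mx : Num.max (expR (- depth p)) (expR (- depth q)) <=
    expR (- depth p) + expR (- depth q).
  by rewrite ge_max lerDl lerDr !expR_ge0.
by apply: le_trans (lerD tri mx) _; rewrite addrACA.
Qed.

Lemma cone_cvg_merge u v x : cone_cvg u x -> cone_cvg v x ->
  forall e : R, 0 < e -> exists N, forall i j, (N <= i)%N -> (N <= j)%N ->
    cone_merge (u i) (v j) < e.
Proof.
move=> ux vx e e0; have e20 : 0 < e / 2 by rewrite divr_gt0.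
have [[N _ uN] [M _ vM]] := (ux _ e20, vx _ e20).
exists (maxn N M) => i j; rewrite !geq_max => /andP[Ni _] /andP[_ Mj].
apply: le_lt_trans (merge_le_sum _ _ x) _.
by have := uN i Ni; have := vM j Mj; rewrite /=; lra.
Qed.

Lemma cone_cvg_infinity u x : cone_cvg u x -> converges_at_infinity o u.
Proof.
move=> ux; rewrite /converges_at_infinity.
apply/(@gromov_product_cvgy (nat * nat) (filter_prod \oo \oo)
    (fun i => u i.1) (fun i => u i.2) _) => e e0.
have [N uN] := cone_cvg_merge ux ux e0.
by exists ([set n | (N <= n)%N], [set n | (N <= n)%N]);
  [split; exists N | case=> i j [/= Ni Nj]; exact: uN].
Qed.

Lemma cone_cvg_asymptotic u v x : cone_cvg u x -> cone_cvg v x -> asymptotic o u v.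
Proof.
move=> ux vx; rewrite /asymptotic; apply/gromov_product_cvgy => e e0.
by have [N uN] := cone_cvg_merge ux vx e0; exists N => // n Nn; exact: uN.
Qed.

Lemma asymptotic_cone_cvg u v x : cone_cvg u x -> asymptotic o u v -> cone_cvg v x.
Proof.
rewrite /asymptotic => ux /gromov_product_cvgy uv e e0.
have e30 : 0 < e / 3 by rewrite divr_gt0.
near=> n.
have un : d (u n).1 x + expR (- depth (u n)) < e / 3 by near: n; exact: ux.
have uvn : cone_merge (u n) (v n) < e / 3 by near: n; exact: uv.
have := bdist_triangle d (u n).1 (v n).1 x; rewrite (bdistC d (v n).1 (u n).1).
have := base_le_merge (u n) (v n); have := expR_gt0 (- depth (u n)).
have : expR (- depth (v n)) <= cone_merge (u n) (v n).
  exact: (expR_le_merge d (cone_coord (u n)) (cone_coord (v n))).2.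
by lra.
Unshelve. all: by end_near. Qed.

Lemma cone_cvg_unique u x y : cone_cvg u x -> cone_cvg u y -> x = y.
Proof.
move=> ux uy; apply: (@bdist_positivity _ _ d); apply/eqP.
rewrite eq_le bdist_ge0 andbT leNgt; apply/negP => xy0.
have xy20 : 0 < d x y / 2 by rewrite divr_gt0.
have [[N _ uN] [M _ uM]] := (ux _ xy20, uy _ xy20).
have := uN _ (leq_maxl N M); have := uM _ (leq_maxr N M) => /=.
have := bdist_triangle d (u (maxn N M)).1 x y; rewrite (bdistC d x (u _).1).
have := expR_gt0 (- depth (u (maxn N M))); lra.
Qed.

Definition vertical_ray x : nat -> cone d := fun n => cone_point d x n%:R.

Lemma vertical_ray_cvg x : cone_cvg (vertical_ray x) x.
Proof.
move=> e e0; have /cvgrPdist_lt /(_ e e0) := @cvgn_expR R.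
apply: filterS => n; rewrite sub0r normrN ger0_norm ?expR_ge0 //.
by rewrite depth_cone_point // bdistxx add0r.
Qed.

Section Complete.
Hypothesis d_complete : bdist_complete d.

Lemma infinity_cone_cvg u : converges_at_infinity o u -> exists x, cone_cvg u x.
Proof.
rewrite /converges_at_infinity => /(@gromov_product_cvgy (nat * nat) (filter_prod \oo \oo)
    (fun i => u i.1) (fun i => u i.2) _) uoo.
have cauchy e : 0 < e -> exists N, forall i j, (N <= i)%N -> (N <= j)%N ->
    cone_merge (u i) (u j) < e.
  move=> /uoo[[P Q] [[N _ NP] [M _ MQ]]] PQ.
  exists (maxn N M) => i j; rewrite !geq_max => /andP[Ni _] /andP[_ Mj].
  exact: (PQ (i, j) (conj (NP _ Ni) (MQ _ Mj))).
have [|x ux] := @d_complete (fun n => (u n).1).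
  move=> e /cauchy[N uN]; exists N => i j Ni Nj.
  exact: le_lt_trans (base_le_merge _ _) (uN i j Ni Nj).
exists x => e e0; have e20 : 0 < e / 2 by rewrite divr_gt0.
have [[N uN] [M uM]] := (ux _ e20, cauchy _ e20).
exists (maxn N M) => // n /=; rewrite geq_max => /andP[Nn Mn].
have := uN n Nn; have := uM n n Mn Mn.
have : expR (- depth (u n)) <= cone_merge (u n) (u n).
  exact: (expR_le_merge d (cone_coord (u n)) (cone_coord (u n))).2.
by lra.
Qed.

Definition ideal_point x : gromov_boundary o :=
  exist _ (boundary_class o (vertical_ray x))
    (mem_set (ex_intro2 _ _ (vertical_ray x)
       (cone_cvg_infinity (vertical_ray_cvg x)) erefl)).

Lemma boundary_class_limit (xi : gromov_boundary o) :
  exists x, set_val xi = [set u | cone_cvg u x].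
Proof.
case: xi => _ /[dup] /set_mem[u ucvg ->] mem; rewrite set_valE /=.
have [x ux] := infinity_cone_cvg ucvg; exists x.
apply/seteqP; split=> v /=.
  by case=> _ /(asymptotic_cone_cvg ux).
move=> vx; split; first exact: cone_cvg_infinity vx.
exact: cone_cvg_asymptotic ux vx.
Qed.

Definition boundary_limit (xi : gromov_boundary o) : T :=
  projT1 (cid (boundary_class_limit xi)).

Lemma boundary_limitP xi : set_val xi = [set u | cone_cvg u (boundary_limit xi)].
Proof. exact: projT2 (cid (boundary_class_limit xi)). Qed.

Lemma boundary_limitK : cancel boundary_limit ideal_point.
Proof.
move=> xi; apply: val_inj => /=; rewrite -[RHS]/(set_val xi) boundary_limitP.
have rx := @vertical_ray_cvg (boundary_limit xi).
apply/seteqP; split=> v /=.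
  by case=> _ /(asymptotic_cone_cvg rx).
move=> vx; split; first exact: cone_cvg_infinity vx.
exact: cone_cvg_asymptotic rx vx.
Qed.

Lemma ideal_pointK : cancel ideal_point boundary_limit.
Proof.
move=> x; apply: (@cone_cvg_unique (vertical_ray x)); last exact: vertical_ray_cvg.
suff : set_val (ideal_point x) (vertical_ray x) by rewrite boundary_limitP.
have rx := vertical_ray_cvg x; rewrite set_valE /=; split.
  exact: cone_cvg_infinity rx.
exact: (cone_cvg_asymptotic rx).
Qed.

Lemma boundary_limit_inj xi eta :
  d (boundary_limit xi) (boundary_limit eta) = 0 -> xi = eta.
Proof. by move=> e; exact: (can_inj boundary_limitK (bdist_positivity e)). Qed.

Lemma cvg_base u x z : cone_cvg u x -> d z (u n).1 @[n --> \oo] --> d z x.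
Proof.
move=> ux; apply/cvgrPdist_lt => e e0; apply: filterS (ux e e0) => n.
have := expR_gt0 (- depth (u n)).
have := bdist_triangle d x z (u n).1; have := bdist_triangle d (u n).1 z x.
by rewrite (bdistC d x (u n).1) ltr_norml; lra.
Qed.

Lemma cvg_merge u v x y : cone_cvg u x -> cone_cvg v y ->
  cone_merge (u n) (v n) @[n --> \oo] --> d x y.
Proof.
move=> ux vy; apply/cvgrPdist_lt => e e0.
have e20 : 0 < e / 2 by rewrite divr_gt0.
near=> n.
have un : d (u n).1 x + expR (- depth (u n)) < e / 2 by near: n; exact: ux.
have vn : d (v n).1 y + expR (- depth (v n)) < e / 2 by near: n; exact: vy.
have := expR_gt0 (- depth (u n)); have := expR_gt0 (- depth (v n)).
have := bdist_triangle d (u n).1 x y; have := bdist_triangle d (v n).1 (u n).1 y.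
have := merge_le_sum (u n) (v n) y; have := base_le_merge (u n) (v n).
have := bdist_triangle d x (u n).1 y.
by rewrite (bdistC d x (u n).1) ltr_norml; lra.
Unshelve. all: by end_near. Qed.

(** All the sequences tending to given ideal points have the same limit of Gromov
    products, so that neither the lower limit nor the supremum matters. *)
Lemma boundary_gromov_product_cone xi eta :
  boundary_gromov_product xi eta =
  let x := boundary_limit xi in let y := boundary_limit eta in
  if x == y then +oo%E
  else (ln (1 + d x0 x) + ln (1 + d x0 y) - ln (d x y))%:E.
Proof.
set x := boundary_limit xi; set y := boundary_limit eta => /=.
have xiE := boundary_limitP xi; have etaE := boundary_limitP eta.
rewrite /boundary_gromov_product xiE etaE -/x -/y.
set L := (X in _ = X).
suff LP u v : cone_cvg u x -> cone_cvg v y ->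
    limn_einf (fun n => (gromov_product o (u n) (v n))%:E) = L.
  rewrite -[RHS]ereal_sup1; congr ereal_sup; apply/seteqP; split=> [l|l ->] /=.
    by case=> u ux [v vy <-]; rewrite (LP u v).
  exists (vertical_ray x); first exact: vertical_ray_cvg.
  exists (vertical_ray y); first exact: vertical_ray_cvg.
  by apply: LP; exact: vertical_ray_cvg.
move=> ux vy; apply: (cvg_limn_einf_sup _).1.
rewrite /L; have [xy|xy] := eqVneq x y.
  rewrite -xy in vy; have /cvgeryP := cone_cvg_asymptotic ux vy; exact.
have dxy := bdist_gt0 xy.
apply: cvg_EFin; first by apply: nearW.
have cvg_ln z w (s : nat -> cone d) : cone_cvg s w ->
    ln (1 + d z (s n).1) @[n --> \oo] --> ln (1 + d z w).
  move=> sw; have pos : 0 < 1 + d z w by rewrite ltr_wpDr ?bdist_ge0.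
  have sz : 1 + d z (s n).1 @[n --> \oo] --> 1 + d z w.
    by apply: cvgD; [exact: cvg_cst | exact: cvg_base].
  exact: (cvg_comp _ _ sz (continuous_ln pos)).
under eq_fun do rewrite /= gromov_product_apex.
apply: cvgB; first by apply: cvgD; exact: cvg_ln.
exact: (cvg_comp _ _ (cvg_merge ux vy) (continuous_ln dxy)).
Qed.

(** The base metric is a visual metric: [exp (- (x|y))] is [d x y] divided by two
    factors [1 + d x0 _] lying between 1 and [e]. *)
Lemma base_visual : exists eps C : R, [/\ 0 < eps, 1 <= C & forall xi eta,
  ((C^-1)%:E * expeR (- (eps%:E * @boundary_gromov_product R (cone d) o xi eta))
     <= (d (boundary_limit xi) (boundary_limit eta))%:E
     <= C%:E * expeR (- (eps%:E * boundary_gromov_product xi eta)))%E].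
Proof.
exists 1, (expR 2); split=> //; first by rewrite -expR0 ler_expR.
move=> xi eta; rewrite mul1e boundary_gromov_product_cone.
set x := boundary_limit xi; set y := boundary_limit eta => /=.
have [->|xy] := eqVneq x y; first by rewrite bdistxx /= !mule0 lexx.
have dxy := bdist_gt0 xy.
rewrite /= -!EFinM !lee_fin -expRN -!expRD.
rewrite -{2 3}(lnK (_ : d x y \is Num.pos)) ?posrE // !ler_expR.
have := ln_base_itv x0 x; have := ln_base_itv x0 y.
by lra.
Qed.

Definition base_visual_metric : visual_metric o :=
  VisualMetric (fun xi => bdistxx d (boundary_limit xi))
    boundary_limit_inj
    (fun xi eta => bdistC d (boundary_limit xi) (boundary_limit eta))
    (fun zeta xi eta => bdist_triangle d (boundary_limit zeta)
       (boundary_limit xi) (boundary_limit eta))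
    base_visual.

End Complete.
End ConeBoundary.

(** With the base metric as visual metric, the limit map from the boundary to the
    base is an isometry. *)
Lemma boundary_cone (R : realType) (T : topologicalType)
    (d : bounded_metric R T) : bdist_complete d ->
  (forall (x : T) (A : set T),
     nbhs x A <-> exists2 e, 0 < e & forall y, d x y < e -> A y) ->
  T -> boundary_homeomorphic_to (cone d) T.
Proof.
move=> dc dnbhs x0; pose rho := base_visual_metric x0 dc.
exists (cone_point d x0 0), rho.
exists (boundary_limit dc), (@ideal_point R T d x0); split.
- exact: boundary_limitK.
- exact: ideal_pointK.
- move=> xi A /dnbhs[e e0 eA].
  apply: filterS (nbhsx_ballx (xi : visual_boundary rho) _ e0) => eta.
  by rewrite ballEmdist => /eA.
- move=> x A.
  rewrite -(metricType_numDomainType.filter_from_mdist_nbhs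
    (ideal_point d x0 x : visual_boundary rho)) => -[e e0 eA].
  apply/dnbhs; exists e => // y xy; apply: eA.
  by rewrite -[mdist _ _]/(d _ _) !ideal_pointK.
Qed.

(** * Metrics with spikes *)

Section Pseudometrics.
Context {R : realType} (T : metricType R).

(** The pseudometrics that are continuous for the topology of [T]; by the triangle
    inequality it suffices to ask for continuity at the diagonal. *)
Record pseudometric : Type := Pseudometric {
  pdist :> T -> T -> R ;
  pdistxx : forall x, pdist x x = 0 ;
  pdistC : forall x y, pdist x y = pdist y x ;
  pdist_triangle : forall z x y, pdist x y <= pdist x z + pdist z y ;
  pdist_continuous : forall x e, 0 < e -> exists2 eta, 0 < eta &
    forall y, mdist x y < eta -> pdist x y < e }.

Definition pdist_zero : pseudometric.
Proof.
exists (fun _ _ => 0).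
- by [].
- by [].
- by move=> *; rewrite addr0.
- by move=> x e e0; exists 1.
Defined.

Definition pdist_max (m n : pseudometric) : pseudometric.
Proof.
exists (fun x y => Num.max (m x y) (n x y)).
- by move=> x; rewrite !pdistxx maxxx.
- by move=> x y; rewrite (pdistC m) (pdistC n).
- move=> z x y; rewrite ge_max; apply/andP; split.
    by apply: le_trans (pdist_triangle m z x y) _; rewrite lerD // le_max lexx.
  apply: le_trans (pdist_triangle n z x y) _.
  by rewrite lerD // le_max lexx orbT.
- move=> x e e0.
  have [[u u0 um] [v v0 vn]] := (pdist_continuous m x e0, pdist_continuous n x e0).
  exists (Num.min u v); first by rewrite lt_min u0.
  by move=> y; rewrite lt_min gt_max => /andP[/um -> /vn ->].
Defined.

Definition pdist_lipschitz (f : T -> R) (L : R) (L0 : 0 < L)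
  (fL : forall x y, `|f x - f y| <= L * mdist x y) : pseudometric.
Proof.
exists (fun x y => `|f x - f y|).
- by move=> x; rewrite subrr normr0.
- by move=> x y; rewrite distrC.
- by move=> z x y; exact: ler_distD.
- move=> x e e0; exists (e / L); first by rewrite divr_gt0.
  by move=> y; rewrite ltr_pdivlMr // mulrC; exact: le_lt_trans (fL x y).
Defined.

Definition pdist_min1 : pseudometric.
Proof.
exists (fun x y => Num.min 1 (mdist x y)).
- by move=> x; rewrite mdistxx min_r.
- by move=> x y; rewrite metric_sym.
- move=> z x y; have := metric_triangle x z y.
  have := mdist_ge0 x z; have := mdist_ge0 z y.
  case: (leP 1 (mdist x y)); case: (leP 1 (mdist x z));
    case: (leP 1 (mdist z y)); lra.
- by move=> x e e0; exists e => // y; rewrite gt_min => ->; rewrite orbT.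
Defined.

Definition bump (q : T) (t eta : R) : T -> R :=
  fun x => Num.max 0 (t - t / eta * mdist q x).

Lemma bump_lipschitz q t eta : 0 < t -> 0 < eta ->
  forall x y, `|bump q t eta x - bump q t eta y| <= t / eta * mdist x y.
Proof.
move=> t0 eta0 x y; have L0 : 0 < t / eta by rewrite divr_gt0.
have := metric_triangle q x y; have := metric_triangle q y x.
rewrite (metric_sym y x) /bump; move: (mdist q x) (mdist q y) (mdist x y) => a b c.
move=> /(ler_wpM2l (ltW L0)) + /(ler_wpM2l (ltW L0)); rewrite !mulrDr.
set L := t / eta in L0 *; move: (L * a) (L * b) (L * c) => {}a {}b {}c ab ba.
rewrite ler_norml; case: (leP 0 (t - a)); case: (leP 0 (t - b)); lra.
Qed.

Lemma bump_itv q t eta x : 0 < t -> 0 < eta -> 0 <= bump q t eta x <= t.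
Proof.
move=> t0 eta0; have := mulr_ge0 (ltW (divr_gt0 t0 eta0)) (mdist_ge0 q x).
by rewrite /bump; case: (leP 0 (t - t / eta * mdist q x)); lra.
Qed.

Lemma bump_center q t eta : 0 < t -> bump q t eta q = t.
Proof. by move=> t0; rewrite /bump mdistxx mulr0 subr0 max_r // ltW. Qed.

Lemma bump_out q t eta x : 0 < t -> 0 < eta -> eta <= mdist q x ->
  bump q t eta x = 0.
Proof.
move=> t0 eta0 qx; rewrite /bump max_l // subr_le0 mulrAC ler_pdivlMr //.
by rewrite ler_pM2l.
Qed.

End Pseudometrics.

Lemma uniform_lower_bound (R : realType) (f : nat -> R) N :
  (forall k, (k < N)%N -> 0 < f k) ->
  exists2 e, 0 < e & forall k, (k < N)%N -> e <= f k.
Proof.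
elim: N => [|N IHN] f0; first by exists 1.
have [|e e0 ef] := IHN; first by move=> k kN; apply: f0; exact: ltnW.
exists (Num.min e (f N)); first by rewrite lt_min e0 f0.
move=> k; rewrite ltnS leq_eqVlt ge_min => /predU1P[->|/ef ->//].
by rewrite lexx orbT.
Qed.

Section Spikes.
Context {R : realType} (T : metricType R).
Hypothesis T_compact : compact [set: T].
Hypothesis T_perfect : forall (x : T) (e : R), 0 < e ->
  exists2 y, y != x & mdist x y < e.
Implicit Types (m : pseudometric T) (e r : R).

(** The filter of the large finite subsets of [T]. *)
Definition seq_filter : set_system (seq T) :=
  fun A => exists s0 : seq T, forall s : seq T, {subset s0 <= s} -> A s.

Instance seq_filter_filter : Filter seq_filter.
Proof.
split; first by exists [::].
- move=> A B [s sA] [s' sB]; exists (s ++ s') => r ss'r; split.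
    by apply: sA => x xs; apply: ss'r; rewrite mem_cat xs.
  by apply: sB => x xs; apply: ss'r; rewrite mem_cat xs orbT.
- by move=> A B AB [s sA]; exists s => r /sA /AB.
Qed.

Lemma pseudometric_net m (r : R) : 0 < r ->
  exists s : seq T, forall x, has (fun y => m x y < r) s.
Proof.
move=> r0; have /compact_near_coveringP cov := T_compact.
have [|s sP] := cov _ _ (fun s x => has (fun y => m x y < r) s) seq_filter_filter.
  move=> x _; have [eta eta0 xeta] := pdist_continuous m x r0.
  exists (ball x eta, [set s | x \in s]).
    split => /=; first exact: nbhsx_ballx.
    by exists [:: x] => s; apply; rewrite mem_head.
  case=> x' s [/= xx' xs]; apply/hasP; exists x => //.
  by rewrite pdistC; apply: xeta; move: xx'; rewrite ballEmdist.
by exists s => x; exact: (sP s).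
Qed.

(** Total boundedness, in the form needed for counting: finitely many cells of
    small diameter. *)
Lemma pseudometric_cells m (r : R) : 0 < r ->
  exists M (c : T -> nat), (forall x, (c x < M)%N) /\
    forall x y, c x = c y -> m x y < r.
Proof.
move=> r0; have [|s sP] := @pseudometric_net m (r / 2); first by rewrite divr_gt0.
exists (size s), (fun x => find (fun y => m x y < r / 2) s); split=> [x|x y cxy].
  by rewrite -has_find.
have xs := nth_find x (sP x); have := nth_find x (sP y); rewrite /= -cxy.
rewrite (pdistC m y) in xs *; set z := nth _ _ _ in xs * => yz.
by have := pdist_triangle m z x y; rewrite /= in xs; lra.
Qed.

(** Adding [b] to [m] creates a spike: [N] points that are close to [p] for [m]
    become [t]-separated, while nothing changes away from [p] nor at scales larger
    than [t]. *)
Definition spikes m (p : T) (t : R) (N : nat) (b : pseudometric T) (q : nat -> T) :=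
  [/\ forall x y, b x y <= t,
      forall x y, t < m p x -> t < m p y -> b x y = 0,
      forall k, (k < N)%N -> m p (q k) <= t
    & forall k l, (k < N)%N -> (l < N)%N -> k <> l -> t <= b (q k) (q l)].

(** As [p] is not isolated, its [m]-neighbourhood contains arbitrarily many points,
    which are pulled apart one after the other: the new point gets the distance
    pulled back by a bump of height [t] that vanishes at all the previous points. *)
Lemma spikes_exist m p t N : 0 < t -> exists b q, spikes m p t N b q.
Proof.
move=> t0; suff [e [q [[? ? ? ?] _]]] : exists b q, spikes m p t N b q /\
    forall k, (k < N)%N -> q k != p by exists e, q.
elim: N => [|N [e [q [[et e0 mq eq] qp]]]].
  by exists (pdist_zero T), (fun=> p); do !split=> //; move=> *; rewrite ltW.
have [eta0 eta00 mp] := pdist_continuous m p t0.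
have [|kap kap0 kapP] := @uniform_lower_bound R (fun k => mdist p (q k)) N.
  by move=> k kN; rewrite mdist_gt0 eq_sym qp.
have [|y yp py] := @T_perfect p (Num.min eta0 kap); first by rewrite lt_min eta00.
move: py; rewrite lt_min => /andP[/mp mpy py].
have tm0 : 0 < t - m p y by rewrite subr_gt0.
have [eta1 eta10 my] := pdist_continuous m y tm0.
have [|kap1 kap10 kap1P] := @uniform_lower_bound R (fun k => mdist y (q k)) N.
  move=> k kN; rewrite mdist_gt0; apply: contraTneq py => ->.
  by rewrite -leNgt kapP.
pose eta := Num.min eta1 kap1.
have etapos : 0 < eta by rewrite lt_min eta10.
have L0 : 0 < t / eta by rewrite divr_gt0.
pose phi := bump y t eta.
pose e' := pdist_max e (pdist_lipschitz L0 (@bump_lipschitz R T y t eta t0 etapos)).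
have phi_q k : (k < N)%N -> phi (q k) = 0.
  by move=> kN; rewrite /phi bump_out // ge_min kap1P ?orbT.
have phi_y : phi y = t by exact: bump_center.
exists e', (fun k => if k == N then y else q k); split; first split.
- move=> x z; rewrite /= ge_max et /=.
  have := bump_itv y x t0 etapos; have := bump_itv y z t0 etapos.
  by rewrite ler_norml; lra.
- move=> x z mx mz; rewrite /= e0 //.
  have phi0 w : t < m p w -> phi w = 0.
    move=> mw; rewrite /phi bump_out // ge_min leNgt; apply/orP; left.
    by apply/negP => /my; have := pdist_triangle m y p w; lra.
  by rewrite -/phi !phi0 // subrr normr0 maxxx.
- move=> k; rewrite ltnS leq_eqVlt; case: eqP => [_ _|_ /= /mq //].
  exact: ltW.
- move=> k l; rewrite !ltnS (leq_eqVlt k) (leq_eqVlt l).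
  case: eqP => [->|_] /=; case: eqP => [->|_] //= kN lN kl.
  + by rewrite -/phi phi_q // phi_y subr0 gtr0_norm // le_max lexx orbT.
  + by rewrite -/phi phi_q // phi_y sub0r normrN gtr0_norm // le_max lexx orbT.
  + by rewrite le_max eq.
- move=> k; rewrite ltnS leq_eqVlt; case: eqP => [//|_ /= kN].
  exact: qp.
Qed.
(** The depth of the [j]th spike.  All that concerns this spike takes place at
    depths at most [horizon j], and the next spike is deeper.  As [horizon j] is
    [j] times the depth of the spike, up to a constant, a quasi-isometric embedding
    does not send the [j]th spike below this horizon when [j] is large. *)
Fixpoint epoch (j : nat) : nat := if j is i.+1 then (i.+1 * (epoch i).+1)%N else 0.

Definition horizon (j : nat) : nat := (j * (epoch j).+1)%N.

Definition scale (n : nat) : R := expR (- n%:R).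

Lemma scale_gt0 n : 0 < scale n. Proof. exact: expR_gt0. Qed.

Lemma scale_le n k : (k <= n)%N -> scale n <= scale k.
Proof. by move=> kn; rewrite ler_expR lerN2 ler_nat. Qed.

Lemma epoch_le_horizon j : (epoch j <= horizon j)%N.
Proof. by case: j => // j; rewrite /horizon mulSn; lia. Qed.

Lemma horizon_le_epochS j : (horizon j <= epoch j.+1)%N.
Proof. by rewrite /horizon /= mulSn; lia. Qed.

Lemma epoch_mono i j : (i <= j)%N -> (epoch i <= epoch j)%N.
Proof.
move=> ij; rewrite -(subnK ij); elim: (j - i)%N => // k IHk.
rewrite addSn; apply: leq_trans IHk _.
exact: leq_trans (epoch_le_horizon _) (horizon_le_epochS _).
Qed.

Lemma leq_epoch j : (j <= epoch j)%N.
Proof. by case: j => // j; rewrite /= mulnS leq_addr. Qed.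

Lemma scale_small e : 0 < e -> exists j, scale (epoch j) < e.
Proof.
move=> e0; have /cvgrPdist_lt /(_ e e0)[N _ NP] := @cvgn_expR R.
exists N; apply: le_lt_trans (scale_le (leq_epoch N)) _.
have := NP N (leqnn N); rewrite /= sub0r normrN ger0_norm ?expR_ge0 //.
Qed.

(** The [N] points [q k] of the spike exceed the number of pairs of a cell of [c]
    and of an integral depth at most [horizon j].  Two points of a cell are close up
    to the scale of the spike everywhere, and up to the scale of the horizon away
    from the spike. *)
Definition spiky (d : T -> T -> R) (p : nat -> T) := forall j,
  exists M (q : nat -> T) (c : T -> nat),
  let N := (M * (horizon j).+1).+1 in
  [/\ forall x, (c x < M)%N,
      forall k, (k < N)%N -> d (p j) (q k) <= scale (epoch j),
      forall k l, (k < N)%N -> (l < N)%N -> k <> l ->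
        scale (epoch j) <= d (q k) (q l),
      forall x y, c x = c y -> d x y <= scale (epoch j)
    & forall x y, c x = c y -> scale (epoch j) < d (p j) x ->
        scale (epoch j) < d (p j) y -> d x y <= scale (horizon j)].

Definition spike_step (p : nat -> T) j m b := exists M q c,
  [/\ forall x, (c x < M)%N, forall x y, c x = c y -> m x y < scale (horizon j)
    & spikes m (p j) (scale (epoch j)) (M * (horizon j).+1).+1 b q].

Lemma spike_step_exists p j m : exists b, spike_step p j m b.
Proof.
have [M [c [cM cm]]] := pseudometric_cells m (scale_gt0 (horizon j)).
have [e [q eq]] := spikes_exist m (p j) (M * (horizon j).+1).+1 (scale_gt0 (epoch j)).
by exists e, M, q, c.
Qed.

(** Each stage depends on the cells of the pseudometric obtained so far. *)
Fixpoint ladder (f : nat -> pseudometric T -> pseudometric T) (j : nat) :=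
  if j is i.+1 then pdist_max (ladder f i) (f i (ladder f i)) else pdist_min1 T.

Section Ladder.
Variables (p : nat -> T) (f : nat -> pseudometric T -> pseudometric T).
Hypothesis fP : forall j m, spike_step p j m (f j m).

Lemma ladder_mono i j x y : (i <= j)%N -> ladder f i x y <= ladder f j x y.
Proof.
move=> ij; rewrite -(subnK ij); elim: (j - i)%N => // k IHk.
by rewrite addSn /= le_max IHk.
Qed.

(** The stages after [j] are invisible at scales larger than that of the [j]th
    spike. *)
Lemma ladder_tail i j x y :
  ladder f i x y <= Num.max (ladder f j x y) (scale (epoch j)).
Proof.
have [ij|/ltnW ji] := leqP i j; first by rewrite le_max ladder_mono.
rewrite -(subnK ji); elim: (i - j)%N => [|k IHk]; first by rewrite le_max lexx.
rewrite addSn /= ge_max IHk /= le_max; apply/orP; right.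
have [M [q [c [_ _ [et _ _ _]]]]] := fP (k + j) (ladder f (k + j)).
apply: le_trans (et _ _) (scale_le (epoch_mono _)); exact: leq_addl.
Qed.

Lemma ladder_le1 i x y : ladder f i x y <= 1.
Proof.
apply: le_trans (ladder_tail i 0 x y) _.
by rewrite /= ge_max ge_min lexx /scale oppr0 expR0 lexx.
Qed.

Definition ladder_sup x y : R := sup [set ladder f j x y | j in [set: nat]].

Lemma ladder_has_sup x y : has_sup [set ladder f j x y | j in [set: nat]].
Proof.
by split; [exists (ladder f 0 x y), 0%N | exists 1 => _ [j _ <-]; exact: ladder_le1].
Qed.

Lemma ladder_le_sup j x y : ladder f j x y <= ladder_sup x y.
Proof. by apply: ub_le_sup; [exact: (ladder_has_sup x y).2 | exists j]. Qed.

Lemma ladder_sup_le x y b : (forall j, ladder f j x y <= b) -> ladder_sup x y <= b.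
Proof.
move=> lb; apply: ge_sup; first exact: (ladder_has_sup x y).1.
by move=> _ [j _ <-].
Qed.

Lemma ladder_sup_tail j x y :
  ladder_sup x y <= Num.max (ladder f j x y) (scale (epoch j)).
Proof. by apply: ladder_sup_le => i; exact: ladder_tail. Qed.

Definition ladder_metric : bounded_metric R T.
Proof.
exists ladder_sup.
- move=> x; apply/eqP; rewrite eq_le ladder_sup_le => [|j]; last by rewrite pdistxx.
  by apply: le_trans (ladder_le_sup 0 x x); rewrite pdistxx.
- move=> x y xy0; apply: mdist_positivity; apply/eqP.
  rewrite eq_le mdist_ge0 andbT; have := ladder_le_sup 0 x y.
  by rewrite xy0 /= ge_min => /orP[|//]; rewrite ler10.
- move=> x y; congr sup; apply: eq_imagel => j _; exact: pdistC.
- move=> z x y; apply: ladder_sup_le => j.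
  apply: le_trans (pdist_triangle _ z x y) _.
  by rewrite lerD // ladder_le_sup.
- by move=> x y; apply: ladder_sup_le => j; exact: ladder_le1.
Defined.

Lemma ladder_metric_spiky : spiky ladder_metric p.
Proof.
move=> j; have [M [q [c [cM cm [et e0 mq eq]]]]] := fP j (ladder f j).
have near x y : c x = c y ->
    ladder_sup x y <= Num.max (f j (ladder f j) x y) (scale (horizon j)).
  move=> cxy; apply: le_trans (ladder_sup_tail j.+1 x y) _.
  rewrite /= !ge_max !le_max lexx /= (ltW (cm x y cxy)) orbT /=.
  by rewrite scale_le ?orbT // horizon_le_epochS.
exists M, q, c; split=> //.
- move=> k kN; apply: le_trans (ladder_sup_tail j _ _) _.
  by rewrite ge_max lexx andbT mq.
- move=> k l kN lN kl; apply: le_trans (eq k l kN lN kl) _.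
  by apply: le_trans (ladder_le_sup j.+1 _ _); rewrite /= le_max lexx orbT.
- move=> x y /near /le_trans; apply; rewrite ge_max et scale_le //.
  exact: epoch_le_horizon.
- move=> x y /near xy px py; apply: le_trans xy _.
  have far z : scale (epoch j) < ladder_sup (p j) z ->
      scale (epoch j) < ladder f j (p j) z.
    by move=> /lt_le_trans /(_ (ladder_sup_tail j _ _)); rewrite lt_max ltxx orbF.
  by rewrite e0 ?far // ge_max lexx ltW // scale_gt0.
Qed.

Lemma ladder_metric_small x e : 0 < e -> exists2 eta, 0 < eta &
  forall y, mdist x y < eta -> ladder_metric x y < e.
Proof.
move=> e0; have [j je] := scale_small e0.
have [eta eta0 xeta] := pdist_continuous (ladder f j) x e0.
exists eta => // y /xeta xy; apply: le_lt_trans (ladder_sup_tail j x y) _.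
by rewrite gt_max xy.
Qed.

Lemma ladder_metric_nbhs x (A : set T) :
  nbhs x A <-> exists2 e, 0 < e & forall y, ladder_metric x y < e -> A y.
Proof.
split=> [/nbhs_ballP[e /= e0 eA]|[e e0 eA]].
  exists (Num.min 1 e); first by rewrite lt_min ltr01.
  move=> y xy; apply: eA; rewrite ballEmdist /=.
  have := le_lt_trans (ladder_le_sup 0 x y) xy; rewrite /= lt_min !gt_min ltxx /=.
  by move=> /andP[m1 /orP[e1|//]]; exact: lt_trans m1 e1.
have [eta eta0 xeta] := ladder_metric_small x e0.
by apply/nbhs_ballP; exists eta => // y; rewrite ballEmdist => /xeta /eA.
Qed.

Lemma ladder_metric_complete : bdist_complete ladder_metric.
Proof.
move=> s cauchy.
have [x [_ xs]] := T_compact (fmap_proper_filter s eventually_filter) filterT.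
exists x => e e0; have e20 : 0 < e / 2 by rewrite divr_gt0.
have [N sN] := cauchy _ e20; exists N => i Ni.
have sFN : (s @ \oo) [set s j | j in [set j | (N <= j)%N]].
  by exists N => // j Nj; exists j.
have xn : nbhs x [set y | ladder_metric x y < e / 2].
  by apply/ladder_metric_nbhs; exists (e / 2).
have [_ [[j Nj <-] xsj]] := xs _ _ sFN xn.
have := bdist_triangle ladder_metric (s j) (s i) x; have := sN i j Ni Nj.
have xsj2 : ladder_metric x (s j) < e / 2 := xsj.
by rewrite (bdistC ladder_metric (s j) x); lra.
Qed.

End Ladder.

Lemma spiky_metric_exists (p : nat -> T) : exists d : bounded_metric R T,
  [/\ spiky d p, bdist_complete d
    & forall (x : T) (A : set T),
      nbhs x A <-> exists2 e, 0 < e & forall y, d x y < e -> A y].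
Proof.
have [f fP] := choice (fun jm => spike_step_exists p jm.1 jm.2).
have fP' j m : spike_step p j m (f (j, m)) by exact: (fP (j, m)).
exists (ladder_metric fP'); split.
- exact: ladder_metric_spiky.
- exact: ladder_metric_complete.
- exact: ladder_metric_nbhs.
Qed.

(** The sequence visits infinitely often each point of a finite [exp (- n)]-net,
    for every [n]: the times [2 ^ n * 3 ^ i * 5 ^ J] belong to the [i]th point of
    the [n]th net. *)
Lemma recurrent_sequence (x0 : T) : exists p : nat -> T,
  forall (x : T) (r : R) J, 0 < r -> exists2 j, (J <= j)%N & mdist x (p j) < r.
Proof.
have net n : exists s : seq T, forall x, has (fun y => mdist x y < scale n) s.
  have sn0 : 0 < Num.min 1 (scale n) by rewrite lt_min ltr01 scale_gt0.
  have [s sP] := pseudometric_net (pdist_min1 T) sn0.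
  exists s => x; apply: sub_has (sP x) => y; rewrite /= lt_min !gt_min ltxx /=.
  by move=> /andP[m1 /orP[e1|//]]; exact: lt_trans m1 e1.
have [s sP] := choice net.
exists (fun j => nth x0 (s (logn 2 j)) (logn 3 j)) => x r J r0.
have [n nr] := scale_small r0.
set N := epoch n in nr; have := nth_find x0 (sP N x); set i := find _ _ => xi.
exists (2 ^ N * 3 ^ i * 5 ^ J)%N.
  apply: leq_trans (ltnW (ltn_expl J (isT : 1 < 5)%N)) _.
  by rewrite leq_pmull // muln_gt0 !expn_gt0.
rewrite !lognM ?muln_gt0 ?expn_gt0 // !lognX !logn_prime //=.
by rewrite !muln0 !muln1 !addn0 add0n; exact: lt_trans xi nr.
Qed.

End Spikes.

(** * Coarse surjectivity *)

Lemma cell_pigeonhole M H (g h : nat -> nat) : let N := (M * H.+1).+1 in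
  (forall k, (k < N)%N -> (g k < M)%N) -> (forall k, (k < N)%N -> (h k <= H)%N) ->
  exists k l, [/\ (k < N)%N, (l < N)%N, k <> l, g k = g l & h k = h l].
Proof.
move=> N gM hH; pose F (k : 'I_N) : 'I_M * 'I_H.+1 :=
  (Ordinal (gM k (ltn_ord k)), Ordinal (hH k (ltn_ord k) : h k < H.+1)%N).
have /injectivePn[k [l kl Fkl]] : ~~ injectiveb F.
  apply/negP => /injectiveP /leq_card.
  by rewrite card_prod !card_ord ltnn.
exists k, l; split=> //; first by move=> /ord_inj; exact/eqP.
  by case: Fkl.
by case: Fkl.
Qed.

Lemma natr_dist (R : realType) (i k : nat) :
  `|i%:R - k%:R| = `|i - k|%N%:R :> R.
Proof.
wlog ik : i k / (i <= k)%N => [wl|].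
  by have [/wl//|/ltnW/wl] := leqP i k; rewrite distrC distnC.
by rewrite distnEr // natrB // ler0_norm ?opprB // subr_le0 ler_nat.
Qed.

Section CoHopf.
Context {R : realType} (T : metricType R) (d : bounded_metric R T).
Variable p : nat -> T.
Hypothesis d_spiky : spiky d p.
Hypothesis p_recurrent : forall (x : T) (r : R) J, 0 < r ->
  exists2 j, (J <= j)%N & d x (p j) < r.

Definition spike_tip (j : nat) : cone d := cone_point d (p j) (epoch j)%:R.

Lemma mdist_level x y (a c : R) : 0 <= a -> 0 <= c -> d x y <= c * expR (- a) ->
  mdist (cone_point d x a) (cone_point d y a) <= 2 * (c + 1).
Proof. by move=> a0 c0 dxy; rewrite mdist_cone_point // cone_dist_horizontal. Qed.

Lemma mdist_top x y : mdist (cone_point d x 0) (cone_point d y 0) <= 4.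
Proof.
have -> : 4 = 2 * (1 + 1) :> R by lra.
by apply: mdist_level; rewrite // oppr0 expR0 mulr1 bdist_le1.
Qed.

(** Points of a cell that is small at their depth, with the same integral depth,
    are at distance at most 4 horizontally and 1 vertically. *)
Lemma mdist_close (y z : cone d) : `|depth y - depth z| <= 1 ->
  d y.1 z.1 <= expR (- depth y) -> mdist y z <= 5.
Proof.
move=> hyz dyz; rewrite -[y]cone_pointE -[z in mdist _ z]cone_pointE.
apply: le_trans (metric_triangle _ (cone_point d z.1 (depth y)) _) _.
have := @mdist_level y.1 z.1 (depth y) 1 (depth_ge0 y) ler01.
rewrite mul1r => /(_ dyz); rewrite mdist_vertical ?depth_ge0 //; lra.
Qed.

(** The points of the spike, taken [s] deeper than its tip, are at distance at most
    [s + 4] from the tip and at least [2 s] from each other.  If their images were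
    not below the tip, up to the error [r] bounding their distance to the image of
    the tip, then they would be at depths where the cells are small; two of them
    lying in the same cell at the same integral depth would be too close. *)
Lemma spike_tip_image (f : cone d -> cone d) (L C : R) : 1 <= L -> 0 < C ->
  (forall x y, L^-1 * mdist x y - C <= mdist (f x) (f y) <= L * mdist x y + C) ->
  exists r J, [/\ 0 <= r & forall j, (J <= j)%N ->
  (epoch j)%:R < depth (f (spike_tip j)) + r /\
  d (p j) (f (spike_tip j)).1 <= expR (2 * r + 1 - (epoch j)%:R)].
Proof.
move=> L1 C0 fLC.
(* images of points at distance [2 * s] are at distance at least 6, more than the
   bound 5 for the points of a cell *)
pose s : R := L * (C + 6) / 2; pose r : R := L * (s + 4) + C.
pose o := cone_point d (p 0%N) 0.
pose K : R := depth (f o) + L * (s + 4) + C + L.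
have L0 : 0 < L by exact: lt_le_trans L1.
have s0 : 0 < s by rewrite divr_gt0 // mulr_gt0 // addr_gt0.
have Ls0 : 0 < L * (s + 4) by rewrite mulr_gt0 // addr_gt0.
have r0 : 0 < r by rewrite addr_gt0.
exists r, (Num.truncn K).+1; split=> [|j Jj]; first exact: ltW.
have Kj : K <= (j%:R : R).
  by apply: le_trans (ltW (truncnS_gt K)) _; rewrite ler_nat.
pose a : R := (epoch j)%:R; rewrite -/a; set w := spike_tip j.
have a0 : 0 <= a by rewrite /a.
have [M [q [c [cM pq qq cell cell_out]]]] := d_spiky j.
set N := (M * _).+1 in pq qq.
pose u k := cone_point d (q k) (a + s).
have as0 : 0 <= a + s by rewrite addr_ge0 // ltW.
have uw k : (k < N)%N -> mdist (u k) w <= s + 4.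
  move=> kN; apply: le_trans (metric_triangle _ (cone_point d (q k) a) _) _.
  rewrite mdist_vertical // lerD //; first by rewrite addrAC subrr add0r gtr0_norm.
  have -> : 4 = 2 * (1 + 1) :> R by lra.
  by apply: mdist_level; rewrite // mul1r bdistC; exact: pq.
have uu k l : (k < N)%N -> (l < N)%N -> k <> l -> 2 * s <= mdist (u k) (u l).
  move=> kN lN kl; rewrite mdist_cone_point //.
  have -> : 2 * s = (a + s) + (a + s) - 2 * a by lra.
  apply: (@cone_dist_ge _ _ d a (q k, a + s) (q l, a + s)).
  apply: le_trans (qq k l kN lN kl) _.
  by rewrite /merge_scale /= lerDl le_max expR_ge0.
have uo k : mdist o (u k) <= 4 + (a + s).
  apply: le_trans (metric_triangle _ (cone_point d (q k) 0) _) _.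
  by rewrite mdist_vertical // lerD ?mdist_top // sub0r normrN ger0_norm.
have fuw k : (k < N)%N -> mdist (f (u k)) (f w) <= r.
  move=> kN; have /andP[_] := fLC (u k) w.
  by have := ler_wpM2l (le_trans ler01 L1) (uw k kN); rewrite /r; lra.
have fuu k l : (k < N)%N -> (l < N)%N -> k <> l -> 6 <= mdist (f (u k)) (f (u l)).
  move=> kN lN kl; have /andP[+ _] := fLC (u k) (u l); apply: le_trans.
  have Li : 0 <= L^-1 by rewrite invr_ge0 (le_trans ler01).
  have := ler_wpM2l Li (uu k l kN lN kl).
  rewrite /s; have -> : L^-1 * (2 * (L * (C + 6) / 2)) = C + 6; last by lra.
  by rewrite (mulrC 2) divfK ?pnatr_eq0 // mulKf // gt_eqF.
have hu k : depth (f (u k)) <= (horizon j)%:R.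
  have := mdist_cone_depth (f o) (f (u k)); rewrite ler_norml => /andP[+ _].
  have /andP[_] := fLC o (u k).
  have := ler_wpM2l (le_trans ler01 L1) (uo k).
  have Lj : L <= (j%:R : R) by have := depth_ge0 (f o); rewrite /K in Kj; lra.
  have hor : (horizon j)%:R = (j%:R : R) * (a + 1) by rewrite natrM -natr1.
  have := ler_wpM2r a0 Lj; rewrite {}hor; clear -Kj L0; rewrite /K in Kj.
  by move: (mdist _ _) (mdist _ _) => *; lra.
have hw k : (k < N)%N -> `|depth (f (u k)) - depth (f w)| <= r.
  by move=> kN; apply: le_trans (mdist_cone_depth _ _) (fuw k kN).
have [||k [l [kN lN kl ckl hkl]]] := @cell_pigeonhole M (horizon j)
    (fun k => c (f (u k)).1) (fun k => Num.truncn (depth (f (u k)))).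
- by move=> k _; exact: cM.
- move=> k _; rewrite -(ler_nat R); apply: le_trans (hu k).
  by rewrite truncn_le // depth_ge0.
have near : `|depth (f (u k)) - depth (f (u l))| <= 1.
  have /andP[k1 k2] := truncn_itv (depth_ge0 (f (u k))).
  have /andP[l1 l2] := truncn_itv (depth_ge0 (f (u l))).
  by rewrite hkl -!natr1 in k1 k2 l1 l2 *; rewrite ler_norml; lra.
have far : expR (- depth (f (u k))) < d (f (u k)).1 (f (u l)).1.
  rewrite ltNge; apply/negP => /(mdist_close near) close.
  by have := fuu k l kN lN kl; lra.
have base k' : (k' < N)%N ->
    d (f (u k')).1 (f w).1 <= expR (r - depth (f w)).
  move=> kN'; apply: le_trans (base_le_expR (fuw k' kN')) _.
  by rewrite ler_expR /=; have := hw k' kN'; rewrite ler_norml /depth /=; lra.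
(* otherwise the scale of the spike is that of a small cell at the depth of the
   images *)
have deep : a < depth (f w) + r.
  rewrite ltNge; apply/negP => shallow.
  have := lt_le_trans far (cell _ _ ckl); rewrite ltr_expR.
  by have := hw k kN; rewrite ler_norml -/a; lra.
(* otherwise the images are away from the spike, where the cells are small down to
   the horizon *)
split=> //; rewrite leNgt; apply/negP => out.
have off k' : (k' < N)%N -> scale (epoch j) < d (p j) (f (u k')).1.
  move=> kN'; have := base k' kN'; have := bdist_triangle d (f (u k')).1 (p j) (f w).1.
  have : expR (r - depth (f w)) <= expR (2 * r - a) by rewrite ler_expR; lra.
  have e1 : 2 <= expR 1 :> R by have := @expR_ge1Dx R 1; lra.
  have -> : (scale (epoch j) : R) = expR (- a) by [].
  have : expR (- a) <= expR (2 * r - a) by rewrite ler_expR; lra.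
  move: out; rewrite -/a -/w.
  have -> : 2 * r + 1 - a = (2 * r - a) + 1 by lra.
  by rewrite (expRD (2 * r - a)); have := ler_wpM2l (expR_ge0 (2 * r - a)) e1; lra.
have := lt_le_trans far (cell_out _ _ ckl (off k kN) (off l lN)).
by rewrite ltr_expR ltrN2 ltNge hu.
Qed.

(** Given [z], choose a spike whose tip is below [z] and much deeper.  The image of
    the vertical segment over the tip shadows the vertical segment over the image
    [w] of the tip, and the latter segment passes near [z], as [w] is below the
    tip. *)
Theorem spiky_cone_coHopfian : qi_coHopfian (cone d).
Proof.
move=> f fqi; split=> //; case: fqi => L [C [L1 C0 fLC]].
have [r [J [r0 tip]]] := spike_tip_image L1 C0 fLC.
pose o := cone_point d (p 0%N) 0.
pose K0 : R := L * 4 + C + mdist (f o) o + 4.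
have L0 : 0 <= L by lra.
have K00 : 0 <= K0 by have := mdist_ge0 (f o) o; rewrite /K0; nra.
have [||||K KP] := @quasigeodesic_shadows_geodesic R (cone d) (ln 4) (L + C)
  (L * (1 + C)) K0 (@cone_four_point _ _ d).
- by rewrite ln_ge0 // ler1n.
- by lra.
- by nra.
- by [].
exists (K + 7) => z; pose x := z.1; pose a : R := depth z.
have a0 : 0 <= a by exact: depth_ge0.
have [j] := p_recurrent x (maxn J (Num.truncn (a + 2 * r + 1)).+1) (expR_gt0 (- a)).
rewrite geq_max => /andP[Jj aj] xpj.
have {}aj : a + 2 * r + 1 <= (epoch j)%:R.
  apply: le_trans (ltW (truncnS_gt _)) _.
  by rewrite ler_nat (leq_trans aj) // leq_epoch.
have [deep close] := tip j Jj.
pose w := f (spike_tip j); rewrite -/w in deep close.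
pose h (i : nat) := f (cone_point d (p j) i%:R).
pose v s := cone_point d w.1 s.
have hi i k : mdist (cone_point d (p j) i%:R) (cone_point d (p j) k%:R)
    = `|i - k|%N%:R.
  by rewrite mdist_vertical // natr_dist.
have [||||||i _ hia] := KP (epoch j) h (depth w) v _ _ _ _ _ a.
- move=> s t /andP[s0 _] /andP[t0 _]; exact: mdist_vertical.
- move=> i _; have /andP[_] := fLC (cone_point d (p j) i%:R)
    (cone_point d (p j) i.+1%:R).
  have -> : mdist (cone_point d (p j) i%:R) (cone_point d (p j) i.+1%:R) = 1 :> R.
    by rewrite mdist_vertical // -natr1 opprD addrA subrr sub0r normrN normr1.
  by rewrite mulr1.
- move=> i k _ _; have /andP[+ _] := fLC (cone_point d (p j) i%:R)
    (cone_point d (p j) k%:R).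
  rewrite hi lerBlDr -/(h i) -/(h k) ler_pdivrMl ?(lt_le_trans ltr01) //.
  move=> /le_trans; apply; rewrite -mulrA ler_wpM2l //.
  by have := mdist_ge0 (h i) (h k); nra.
- apply: le_trans (metric_triangle _ (f o) _) _.
  have := metric_triangle (f o) o (v 0); have := mdist_top (p 0%N) w.1.
  have /andP[_] := fLC (cone_point d (p j) 0) o.
  have := ler_wpM2l L0 (mdist_top (p j) (p 0%N)).
  by rewrite /h /v /K0; lra.
- have -> : v (depth w) = h (epoch j) by exact: cone_pointE.
  by rewrite mdistxx.
- by rewrite a0 /=; lra.
exists (cone_point d (p j) i%:R).
apply: le_lt_trans (metric_triangle _ (v a) _) _.
have : mdist (v a) z <= 2 * (2 + 1).
  rewrite -[z]cone_pointE; apply: mdist_level => //.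
  have : expR (2 * r + 1 - (epoch j)%:R) <= expR (- a) by rewrite ler_expR; lra.
  have := bdist_triangle d (p j) w.1 x; rewrite (bdistC d w.1 (p j)) (bdistC d (p j) x).
  by rewrite -/a -/x; lra.
rewrite -/(h i); lra.
Qed.

End CoHopf.

(** * The Menger curve *)

Section MetricSubset.
Context {R : realType} {V : normedModType R} (A : set V).

(** A copy of the subtype carrying the metric induced by the norm. *)
Definition metric_subset : Type := set_type A.

HB.instance Definition _ := Choice.on metric_subset.
HB.instance Definition _ := isMetric.Build R metric_subset
  (fun x => etrans (congr1 Num.norm (subrr (set_val x))) (normr0 _))
  (fun x y xy0 => val_inj (subr0_eq (normr0_eq0 xy0)))
  (fun x y => distrC (set_val x) (set_val y))
  (fun y x z => ler_distD (set_val y) (set_val x) (set_val z)).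

Definition subset_point (x : V) (Ax : A x) : metric_subset :=
  exist (fun x => x \in A) x (mem_set Ax).

Lemma mdist_subsetE (x y : metric_subset) :
  mdist x y = `|set_val x - set_val y|.
Proof. by []. Qed.

Lemma metric_subset_compact : compact A -> compact [set: metric_subset].
Proof.
move=> cA F FF _.
have GF : ProperFilter (set_val @ F : set_system V) by exact: fmap_proper_filter.
have FA : F [set y | A (set_val y)].
  by apply: filterS filterT => y _; exact: (@set_valP _ A y).
have [x [Ax xF]] := cA _ GF FA.
exists (subset_point Ax); split=> // B C FB /nbhs_ballP[e /= e0 eC].
have FvB : F [set b : metric_subset | (set_val @` B) (set_val b)].
  by apply: filterS FB => b Bb; exists b.
have [_ [[b Bb <-] xb]] := xF _ _ FvB (nbhsx_ballx x e e0).
exists b; split=> //; apply: eC; rewrite ballEmdist /= mdist_subsetE.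
by move: xb; rewrite -ball_normE.
Qed.

Lemma metric_subset_homeomorphic : homeomorphic metric_subset (set_type A).
Proof.
exists (fun x : metric_subset => x : set_type A),
  (fun x : set_type A => x : metric_subset); split=> //.
- apply: (@continuous_comp_initial _ metric_subset V set_val) => x U.
  move=> /nbhs_ballP[e /= e0 eU].
  apply: (@filterS _ _ _ (ball (x : metric_subset) e)); last exact: nbhsx_ballx.
  by move=> y; rewrite ballEmdist => xy; apply: eU; rewrite -ball_normE.
- move=> x U /(@nbhs_ballP _ metric_subset)[e /= e0 eU].
  have := @initial_continuous _ _ (set_val : set_type A -> V) x.
  move=> /cvgrPdist_lt /(_ e e0); apply: filterS => y xy.
  by apply: eU; rewrite ballEmdist.
Qed.

End MetricSubset.

Lemma boundary_homeomorphic_trans (R : realType) (X : metricType R)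
    (S T : topologicalType) :
  boundary_homeomorphic_to X S -> homeomorphic S T ->
  boundary_homeomorphic_to X T.
Proof.
move=> [z [rho [f [g [fg gf cf cg]]]]] [f' [g' [fg' gf' cf' cg']]].
exists z, rho, (f' \o f), (g \o g'); split.
- exact: can_comp.
- exact: can_comp.
- by move=> x; apply: continuous_comp; [exact: cf | exact: cf'].
- by move=> x; apply: continuous_comp; [exact: cg' | exact: cg].
Qed.

Section MengerCurve.
Context {R : realType}.
Implicit Types (c : 'I_3 -> nat) (m k : nat) (x y : 'rV[R]_3).

Lemma triadic_le m k (a b : nat) : (a * 3 ^ k <= b)%N ->
  a%:R / 3 ^+ m <= b%:R / 3 ^+ (m + k) :> R.
Proof.
move=> ab; rewrite ler_pdivrMr ?exprn_gt0 // exprD invfM mulrA mulrAC.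
rewrite mulrVK ?unitfE ?expf_neq0 // ler_pdivlMr ?exprn_gt0 //.
by rewrite -natrX -natrM ler_nat.
Qed.

Lemma triadic_ge m k (a b : nat) : (b <= a * 3 ^ k)%N ->
  b%:R / 3 ^+ (m + k) <= a%:R / 3 ^+ m :> R.
Proof.
move=> ab; rewrite ler_pdivlMr ?exprn_gt0 // exprD invfM mulrA mulrAC.
rewrite mulrVK ?unitfE ?expf_neq0 // ler_pdivrMr ?exprn_gt0 //.
by rewrite -natrX -natrM ler_nat.
Qed.

Lemma menger_levelS m : menger_level m.+1 `<=` (menger_level m : set 'rV[R]_3).
Proof.
move=> x [c [cm _] xc]; exists (fun i => c i %/ 3)%N => // i.
have /andP[cx xc1] := xc i; apply/andP; split.
  apply: le_trans cx; rewrite -[m.+1]addn1; apply: triadic_le; lia.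
apply: le_trans xc1 _; rewrite -[m.+1]addn1; apply: triadic_ge; lia.
Qed.

Lemma menger_level_le m k : (m <= k)%N ->
  menger_level k `<=` (menger_level m : set 'rV[R]_3).
Proof.
move=> mk; rewrite -(subnK mk); elim: (k - m)%N => // n IHn.
by rewrite addSn; apply: subset_trans IHn; exact: menger_levelS.
Qed.

Definition corner m c (b : 'I_3 -> bool) : 'rV[R]_3 :=
  \row_i ((c i + b i)%:R / 3 ^+ m).

(** At each level after [m], the corner is also a corner of the subcube whose new
    digits in base 3 are, in each coordinate, all equal to 0 or all equal to 2;
    only cubes with some digits equal to 1 are removed. *)
Lemma corner_menger m c b : menger_cubes m c -> menger_curve R (corner m c b).
Proof.
move=> cm; suff lev k : menger_level (m + k) (corner m c b).
  by move=> n _; apply: (@menger_level_le n (m + n)); rewrite ?leq_addl.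
exists (fun i => c i * 3 ^ k + b i * (3 ^ k - 1))%N.
  elim: k => [|k IHk].
    rewrite addn0; have -> // : (fun i => (c i * 3 ^ 0 + b i * (3 ^ 0 - 1))%N) = c.
    by apply/funext => i; rewrite expn0 subnn muln0 muln1 addn0.
  rewrite addnS; split.
    have -> // : (fun i => (c i * 3 ^ k.+1 + b i * (3 ^ k.+1 - 1)) %/ 3)%N =
        (fun i => c i * 3 ^ k + b i * (3 ^ k - 1))%N.
    apply/funext => i; have := expn_gt0 3 k; rewrite expnS.
    by case: (b i); rewrite ?mul1n ?mul0n; lia.
  rewrite (_ : [set i | _]%SET = finset.set0) ?cards0 //.
  apply/setP => i; rewrite !inE; have := expn_gt0 3 k; rewrite expnS.
  by case: (b i); rewrite ?mul1n ?mul0n; lia.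
move=> i; rewrite mxE; have := expn_gt0 3 k => k0; apply/andP; split.
  by apply: triadic_ge; case: (b i); lia.
by apply: triadic_le; case: (b i); lia.
Qed.

Lemma corner_in_cube m c b : triadic_cube m c (corner m c b).
Proof.
move=> i; rewrite mxE !ler_pM2r ?invr_gt0 ?exprn_gt0 // !ler_nat.
by case: (b i); lia.
Qed.

Lemma row_norm_lt (n : nat) (v : 'rV[R]_n) (r : R) : 0 < r ->
  (forall i, `|v ord0 i| < r) -> `|v| < r.
Proof.
move=> r0 vr; rewrite /Num.norm /= mx_normrE; apply: bigmax_lt => // -[j i] _ /=.
by rewrite ord1.
Qed.

Lemma triadic_cube_diam m c x y (r : R) : triadic_cube m c x ->
  triadic_cube m c y -> (3 ^+ m)^-1 < r -> `|x - y| < r.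
Proof.
move=> xc yc mr; apply: row_norm_lt.
  by apply: lt_trans mr; rewrite invr_gt0 exprn_gt0.
move=> i; rewrite !mxE ltr_norml; have := xc i; have := yc i.
by rewrite -[(c i).+1]addn1 natrD mulrDl mul1r; lra.
Qed.

(** Two distinct corners of a small cube containing [x] cannot both be [x]. *)
Lemma menger_perfect (x : metric_subset (menger_curve R)) (e : R) : 0 < e ->
  exists2 y, y != x & mdist x y < e.
Proof.
move=> e0; pose m := Num.truncn e^-1.
have m3 : (3 ^+ m.+1)^-1 < e.
  rewrite invf_plt ?posrE ?exprn_gt0 //; apply: lt_trans (truncnS_gt _) _.
  by rewrite -natrX ltr_nat ltn_expl.
have [c cm xc] := @set_valP _ (menger_curve R) x m.+1 I.
pose y b : metric_subset (menger_curve R) :=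
  subset_point (corner_menger b cm).
have xy b : mdist x (y b) < e.
  exact: triadic_cube_diam xc (corner_in_cube _ _ _) m3.
have [xy0|] := eqVneq (y (fun=> false)) x; last by exists (y (fun=> false)).
exists (y (fun=> true)) => //; rewrite -xy0; apply/eqP => /(congr1 set_val).
move=> /rowP /(_ ord0); rewrite !mxE => /(mulIf _) H.
have /H/eqP : (3 ^+ m.+1)^-1 != 0 :> R by rewrite invr_neq0 // expf_neq0.
by rewrite eqr_nat addn0 addn1 => /eqP; lia.
Qed.

Lemma triadic_cube_closed m c : closed (triadic_cube m c : set 'rV[R]_3).
Proof.
have -> : triadic_cube m c = \bigcap_(i in [set: 'I_3])
    ((fun x : 'rV[R]_3 => x ord0 i) @^-1`
      `[(c i)%:R / 3 ^+ m, (c i).+1%:R / 3 ^+ m]%classic).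
  apply/seteqP; split=> x /= xc i; first by move=> _ /=; rewrite in_itv /= xc.
  by have := xc i I; rewrite /= in_itv.
apply: closed_bigI => i _; apply: closed_comp; last exact: itv_closed.
by move=> x _; exact: coord_continuous.
Qed.

Lemma menger_cubes_bound m c : menger_cubes m c -> forall i, (c i < 3 ^ m)%N.
Proof.
elim: m c => [|m IHm] c /=; first by move=> c0 i; rewrite c0.
by case=> /IHm cm _ i; have := cm i; rewrite expnS; lia.
Qed.

Lemma menger_cubes_finite m : finite_set (menger_cubes m).
Proof.
apply: (@sub_finite_set _ _ [set (fun i => nat_of_ord (g i)) |
  g in [set: {ffun 'I_3 -> 'I_(3 ^ m)}]]).
  move=> c cm; exists [ffun i => Ordinal (menger_cubes_bound cm i)] => //.
  by apply/funext => i; rewrite ffunE.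
by apply: finite_image; exact: finite_finset.
Qed.

Lemma menger_compact : compact (menger_curve R).
Proof.
apply: bounded_closed_compact.
  exists 1; split=> // M M1 x /(_ 0%N I)[c c0 xc] /=.
  apply: ltW; apply: row_norm_lt => [|i]; first exact: lt_trans M1.
  have := xc i; rewrite c0 expr0 !divr1 => ?.
  by rewrite ger0_norm; lra.
apply: closed_bigI => m _; apply: closed_bigcup; first exact: menger_cubes_finite.
by move=> c _; exact: triadic_cube_closed.
Qed.

Definition menger_origin : metric_subset (menger_curve R) :=
  subset_point (@corner_menger 0 (fun=> 0%N) (fun=> false) (fun=> erefl)).

End MengerCurve.

Theorem compact_perfect_coHopfian (R : realType) (T : metricType R) :
  compact [set: T] ->
  (forall (x : T) (e : R), 0 < e -> exists2 y, y != x & mdist x y < e) ->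
  T ->
  exists X : metricType R,
    [/\ gromov_hyperbolic X, roughly_geodesic X, visual X, qi_coHopfian X
      & boundary_homeomorphic_to X T].
Proof.
move=> cT pT x0.
have [p pP] := recurrent_sequence cT x0.
have [d [dp dc dn]] := spiky_metric_exists cT pT p.
exists (cone d); split.
- exact: gromov_hyperbolic_cone.
- exact: roughly_geodesic_cone.
- exact: visual_cone x0.
- apply: (spiky_cone_coHopfian dp) => x r J r0.
  have /nbhs_ballP[e /= e0 er] : nbhs x [set y | d x y < r].
    by apply/dn; exists r.
  have [j Jj xj] := pP x e J e0.
  by exists j => //; apply: er; rewrite ballEmdist.
- exact: boundary_cone dc dn x0.
Qed.

Theorem theorem1p7 (R : realType) :
  exists X : metricType R,
    [/\ gromov_hyperbolic X, roughly_geodesic X, visual X, qi_coHopfian X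
      & boundary_homeomorphic_to X (set_type (menger_curve R))].
Proof.
have [X [hyp geo vis coH bd]] := compact_perfect_coHopfian
  (metric_subset_compact (@menger_compact R)) (@menger_perfect R) menger_origin.
exists X; split=> //.
exact: boundary_homeomorphic_trans bd (metric_subset_homeomorphic _).
Qed.
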